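(* There is an algorithm which, given a diamond-free graph $G=(V,E)$ by adjacency lists, decides in time $O(|V|+|E|)$ whether $G$ is CIS.
   Context: A clique is strong if it intersects every inclusion-maximal stable set; a graph is CIS if every inclusion-maximal clique is strong. The diamond is $K_4$ minus one edge; diamond-free means no induced subgraph isomorphic to the diamond. Running time is measured in the standard RAM model. *)

(* Defs.v *)
From mathcomp Require Import all_boot.
Set Implicit Arguments. Unset Strict Implicit. Unset Printing Implicit Defensive.

Section Graphs.
Variable T : finType.
Variable e : rel T.

Definition simple_graph : Prop := symmetric e /\ irreflexive e.

Definition clique : pred {set T} :=
  fun K => [forall x in K, forall y in K, (x != y) ==> e x y].
Definition stable : pred {set T} :=
  fun S => [forall x in S, forall y in S, (x != y) ==> ~~ e x y].

Definition strong_clique (K : {set T}) : bool :=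
  [forall S : {set T}, maxset stable S ==> (K :&: S != set0)].

Definition is_CIS : bool :=
  [forall K : {set T}, maxset clique K ==> strong_clique K].

Definition diamond_free : Prop :=
  ~ exists a b c d : T,
      [/\ uniq [:: a; b; c; d],
          [&& e a b, e a c, e a d, e b c & e b d] & ~~ e c d].

Definition num_edges : nat :=
  #|[set p : T * T | (enum_rank p.1 < enum_rank p.2)%N && e p.1 p.2]|.
End Graphs.

Definition adj_lists (n : nat) (e : rel 'I_n) (adj : 'I_n -> seq 'I_n) : Prop :=
  forall v : 'I_n, uniq (adj v) /\ (forall u, (u \in adj v) = e v u).

Definition encode_adj (n : nat) (adj : 'I_n -> seq 'I_n) : seq nat :=
  n :: flatten [seq size (adj v) :: map (@nat_of_ord n) (adj v) | v <- enum 'I_n].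

(* Unit-cost RAM model: infinitely many registers indexed by nat,      *)
(* holding naturals; constants, addition, (truncated) subtraction,     *)
(* direct and indirect addressing, conditional/unconditional jumps.    *)
(* Each executed instruction costs one time step.                      *)
Inductive instr : Type :=
| IConst of nat & nat
| IAdd of nat & nat & nat
| ISub of nat & nat & nat
| ILoad of nat & nat
| IStore of nat & nat
| IJz of nat & nat
| IJmp of nat.

Definition program := seq instr.

Record state := State { pc : nat; mem : nat -> nat }.

Definition upd (m : nat -> nat) (a v : nat) : nat -> nat :=
  fun x => if x == a then v else m x.

Definition halted (P : program) (s : state) : bool := (size P <= pc s)%N.

(* One step; a halted state (pc outside the program) is left unchanged. *)
Definition step (P : program) (s : state) : state :=
  let m := mem s in
  let p := pc s in
  match nth (IJmp p) P p with
  | IConst i c => State p.+1 (upd m i c)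
  | IAdd i j k => State p.+1 (upd m i (m j + m k))
  | ISub i j k => State p.+1 (upd m i (m j - m k))
  | ILoad i j => State p.+1 (upd m i (m (m j)))
  | IStore i j => State p.+1 (upd m (m i) (m j))
  | IJz i l => State (if m i == 0 then l else p.+1) m
  | IJmp l => State l m
  end.

Definition run (P : program) (t : nat) (s : state) : state :=
  iter t (fun s' => if halted P s' then s' else step P s') s.

Definition init_state (w : seq nat) : state :=
  State 0 (fun a => if a is a'.+1 then nth 0 w a' else size w).

Definition decides_within (P : program) (w : seq nat) (b : bool) (t : nat) : Prop :=
  let s := run P t (init_state w) in halted P s /\ mem s 0 = nat_of_bool b.

(* Main.v *)
Require Import Defs.
From mathcomp Require Import all_boot zify.

Set Implicit Arguments. Unset Strict Implicit. Unset Printing Implicit Defensive.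

(** In a diamond-free graph every edge lies in exactly one maximal clique (a
    line). A line is strong unless one can choose, for each of its vertices, a
    neighbour outside the line so that the chosen vertices are pairwise
    nonadjacent; in particular a line with a simplicial vertex is strong.
    Suppose that all lines are strong and K is a line of size k without a
    simplicial vertex. A minimal subset of K without such a choice shows, by
    induction on k, that all lines in the component of K have size k and no
    simplicial vertex, and the component is complete bipartite (k = 2) or the
    k x k rook's graph (k > 2). Both shapes can be tested locally: in the first
    case adjacent vertices are compared through their largest neighbours; in the
    second case every vertex lies on exactly two lines, both of size k, and it
    suffices to count that the component, labelled by its largest vertex (found
    within distance 2), has k^2 vertices.

    On the RAM the adjacency matrix costs only linear time, as memory is
    initially zero: only the entries of edges and of the diagonal are written. *)

(** * Lines and transversals *)

(** The rigidity of the sizes comes from a count. Let [J] be a minimal subset of [K] without a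
    choice and [j] in [J]. A choice for [J] minus [j] dominates every other line through [j] apart
    from [j] itself. Each chosen vertex sees at most one vertex of such a line, so the line has at
    most #|J| vertices; each dominated vertex has a neighbour off the line, so it is not simplicial.
    A line smaller than [K] would by induction force [K] to be smaller too, so all sizes agree and
    [J] is [K]. The obstacle on the algorithmic side is that the tests are local, whereas a rook's
    graph is a global shape. On acceptance nothing is known about components: the tests only yield a
    set of at most k^2 vertices, closed under adjacency. But k^2 is already the size of the closed
    neighbourhood of any line inside it, so each of these lines dominates the whole set. This
    excludes transversals, and no rook's graph ever has to be recognised. *)

Section DiamondFree.
Variables (T : finType) (e : rel T).
Hypotheses (esym : symmetric e) (eirr : irreflexive e) (df : diamond_free e).

Definition nbr v := [set u | e v u].
(** The intersection of the closed neighbourhoods of the ends; for an edge [u v] this is the one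
    maximal clique that contains it. *)
Definition cl u v := [set x | ((x == u) || e u x) && ((x == v) || e v x)].
Definition simp v := [forall x in nbr v, forall y in nbr v, (x != y) ==> e x y].
(** The size condition keeps out isolated vertices. Maximality is expressed through pairs, so that
    two vertices determine a line; [line_maxset] and [maxset_line] give the agreement with maximal
    cliques. *)
Definition line (K : {set T}) :=
  [/\ 1 < #|K|, {in K &, forall a b, a != b -> e a b} &
    forall a b x, a \in K -> b \in K -> a != b -> e a x -> e b x -> x \in K].
Definition ns (K : {set T}) := line K /\ {in K, forall x, ~~ simp x}.

Lemma e_neq x y : e x y -> x != y.
Proof. by case: eqP => // ->; rewrite eirr. Qed.

Lemma common_nbrs_adjacent u v a b :
  e u v -> e u a -> e u b -> e v a -> e v b -> a != b -> e a b.
Proof.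
move=> uv ua ub va vb ab; apply/negPn/negP => nab; apply: df.
exists u, v, a, b; split => //; last by rewrite uv ua ub va vb.
by rewrite /= !inE !negb_or (e_neq uv) (e_neq ua) (e_neq ub) (e_neq va) (e_neq vb) ab.
Qed.

Lemma clC u v : cl u v = cl v u.
Proof. by apply/setP => x; rewrite !inE andbC. Qed.

Lemma cl_l u v : e u v -> u \in cl u v.
Proof. by move=> uv; rewrite inE eqxx esym uv orbT. Qed.

Lemma cl_r u v : e u v -> v \in cl u v.
Proof. by move=> uv; rewrite clC cl_l // esym. Qed.

Lemma cl_nbr u v x : x \in cl u v -> x != u -> e u x.
Proof. by rewrite inE => /andP[/orP[->|]]. Qed.

Lemma in_cl u v x : e u x -> e v x -> x \in cl u v.
Proof. by rewrite inE => -> ->; rewrite !orbT. Qed.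

Lemma line_cl u v : e u v -> line (cl u v).
Proof.
move=> uv; have vu : e v u by rewrite esym.
have cadj a b : a \in cl u v -> b \in cl u v -> a != b -> e a b.
  rewrite !inE => /andP[/orP[/eqP->|ua] va] /andP[ub vb] ab.
    by move: ub; rewrite eq_sym (negPf ab).
  case/orP: va => [/eqP av|va]; first by move: vb; rewrite -av eq_sym (negPf ab).
  case/orP: ub => [/eqP->|ub]; first by rewrite esym.
  case/orP: vb => [/eqP->|vb]; first by rewrite esym.
  exact: (common_nbrs_adjacent uv).
split => //.
  apply: (@leq_trans #|[set u; v]|); first by rewrite cards2 (e_neq uv).
  by apply/subset_leq_card/subsetP => x; rewrite in_set2 => /orP[]/eqP->; rewrite ?cl_l ?cl_r.
move=> a b x aK bK ab ax bx.
(* Unless it is [a] or [b] itself, [w] sees the edge [a b], as does [x]; so the two are equal or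
   adjacent. *)
have closer w : w \in cl u v -> (x == w) || e w x.
  move=> wK; have [wx|nwx] := eqVneq x w; first by [].
  have [->|wa] := eqVneq w a; first by rewrite ax orbT.
  have [->|wb] := eqVneq w b; first by rewrite bx orbT.
  rewrite (common_nbrs_adjacent (cadj _ _ aK bK ab)) ?orbT // ?(cadj a) ?(cadj b) //.
  - by rewrite eq_sym.
  - by rewrite eq_sym.
  - by rewrite eq_sym.
by rewrite inE !closer ?cl_l ?cl_r.
Qed.

Lemma line_eq K a b : line K -> a \in K -> b \in K -> a != b -> K = cl a b.
Proof.
move=> [_ adj mx] aK bK ab; apply/setP => x; apply/idP/idP => [xK|].
  rewrite inE; have [->|xa] := eqVneq x a.
    by rewrite /= adj ?orbT // eq_sym.
  rewrite (adj a) // 1?eq_sym //=.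
  by have [->//|xb] := eqVneq x b; rewrite /= adj // eq_sym.
rewrite inE => /andP[/orP[/eqP->//|ax] /orP[/eqP->//|bx]].
exact: mx ab ax bx.
Qed.

Lemma line_one K a b x : line K -> a \in K -> b \in K -> x \notin K ->
  e a x -> e b x -> a = b.
Proof.
move=> [_ _ mx] aK bK xK ax bx; apply/eqP/negPn/negP => ab.
by case/negP: xK; apply: mx ab ax bx.
Qed.

Lemma line_maxset K : line K -> maxset (clique e) K.
Proof.
move=> [K1 adj mx]; apply/maxsetP; split.
  by apply/forall_inP => x xK; apply/forall_inP => y yK; apply/implyP; apply: adj.
move=> B /forall_inP Bc KB; apply/eqP; rewrite eqEsubset KB andbT.
have /card_gt1P[a [b [aK bK ab]]] := K1.
have BE x y : x \in B -> y \in B -> x != y -> e x y.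
  by move=> xB yB; apply/implyP; move: (Bc _ xB) => /forall_inP; apply.
apply/subsetP => x xB.
have [->//|xa] := eqVneq x a; have [->//|xb] := eqVneq x b.
by apply: (mx a b) => //; apply: BE => //; rewrite ?(subsetP KB) // eq_sym.
Qed.

Lemma maxset_line K : maxset (clique e) K -> 1 < #|K| -> line K.
Proof.
move=> /maxsetP[/forall_inP Kc Kmax] K1.
have KE x y : x \in K -> y \in K -> x != y -> e x y.
  by move=> xB yB; apply/implyP; move: (Kc _ xB) => /forall_inP; apply.
split => // a b x aK bK ab ax bx.
have [_ ladj _] := line_cl (KE _ _ aK bK ab).
rewrite -(Kmax (cl a b)); first exact: in_cl.
  by apply/forall_inP => y yK; apply/forall_inP => z zK; apply/implyP; apply: ladj.
apply/subsetP => y yK; rewrite inE.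
have [->|ya] := eqVneq y a; first by rewrite /= KE ?orbT // eq_sym.
rewrite (KE a) //= 1?eq_sym //.
by have [//|yb] := eqVneq y b; rewrite KE // eq_sym.
Qed.

Lemma simpP v : reflect (forall x y, e v x -> e v y -> x != y -> e x y) (simp v).
Proof.
apply: (iffP forall_inP) => [h x y vx vy xy|h x].
  have /forall_inP h1 := h x ltac:(by rewrite inE).
  by apply: (implyP (h1 y _)); rewrite ?inE.
by rewrite inE => vx; apply/forall_inP => y; rewrite inE => vy; apply/implyP; apply: h.
Qed.

Lemma nsimp_intro v x y : e v x -> e v y -> x != y -> ~~ e x y -> ~~ simp v.
Proof. by move=> vx vy xy nxy; apply/negP => /simpP h; rewrite h in nxy. Qed.

Lemma ns_outside K c : ns K -> c \in K -> exists2 x, e c x & x \notin K.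
Proof.
move=> [[K1 adj mx] nsK] cK.
case: (pickP (fun x => e c x && (x \notin K))) => [x /andP[]|none]; first by exists x.
have inK x : e c x -> x \in K by move=> cx; have := none x; rewrite cx /= => /negbFE.
case/negP: (nsK _ cK); apply/simpP => x y cx cy; apply: adj; exact: inK.
Qed.

(** Distinctness of the chosen vertices need not be asked: a vertex outside a line sees at most one
    vertex of it. *)
Definition partial (K J : {set T}) (x : T -> T) :=
  (forall c, c \in J -> e c (x c) && (x c \notin K)) /\
  (forall c d, c \in J -> d \in J -> ~~ e (x c) (x d)).

Definition transversal (K : {set T}) (x : T -> T) := partial K K x.

Lemma stable_extends (S : {set T}) : stable e S -> exists2 S', maxset (stable e) S' & S \subset
  S'.
Proof. by move=> /maxset_exists[B mB sB]; exists B. Qed.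

Lemma stableP (S : {set T}) :
  reflect (forall x y, x \in S -> y \in S -> ~~ e x y) (stable e S).
Proof.
apply: (iffP forall_inP) => [h x y xS yS|h x xS].
  have [->|xy] := eqVneq x y; first by rewrite eirr.
  by move: (h _ xS) => /forall_inP/(_ _ yS); rewrite xy.
by apply/forall_inP => y yS; apply/implyP => _; apply: h.
Qed.

Lemma max_stable_dominates S c : maxset (stable e) S -> c \notin S ->
  exists2 s, s \in S & e c s.
Proof.
move=> /maxsetP[/stableP Sst Smax] cS.
case: (pickP (fun s => (s \in S) && e c s)) => [s /andP[]|none]; first by exists s.
have ncs s : s \in S -> ~~ e c s by move=> sS; have := none s; rewrite sS /= => ->.
case/negP: cS; rewrite -(Smax (c |: S)) ?setU11 ?subsetUr //.
apply/stableP => x y /setU1P[->|xS] /setU1P[->|yS]; rewrite ?eirr ?ncs //.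
  by rewrite esym ncs.
exact: Sst.
Qed.

(** A maximal stable set that contains the chosen vertices avoids [K], because each vertex of [K]
    has its chosen neighbour in it. *)
Lemma strong_no_transversal K x : strong_clique e K -> ~ transversal K x.
Proof.
move=> /forallP st [dom sb].
have /stable_extends[S mS sS] : stable e (x @: K).
  by apply/stableP => _ _ /imsetP[c cK ->] /imsetP[d dK ->]; apply: sb.
have := st S; rewrite mS /= => /set0Pn[c /setIP[cK cS]].
have /maxsetP[/stableP/(_ c (x c) cS) h _] := mS.
have /andP[exc _] := dom _ cK.
by move: h; rewrite exc => /(_ (subsetP sS _ (imset_f x cK))).
Qed.

(** A maximal stable set that misses [K] dominates it, and picking for each vertex of [K] a
    neighbour in that set gives a transversal. *)
Lemma no_transversal_strong K : (forall x, ~ transversal K x) -> strong_clique e K.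
Proof.
move=> nt; apply/forallP => S; apply/implyP => mS; apply/negP => /eqP KS0.
have nKS c : c \in K -> c \notin S.
  by move=> cK; apply/negP => cS; have : c \in K :&: S; [rewrite inE cK cS | rewrite KS0 inE].
pose x c := odflt c [pick s in S | e c s].
have xP c : c \in K -> x c \in S /\ e c (x c).
  move=> cK; rewrite /x; case: pickP => [s /andP[]//|none].
  by have [s sS cs] := max_stable_dominates mS (nKS c cK); have := none s; rewrite /= sS cs.
apply: (nt x); split => [c cK|c d cK dK].
  have [sS ->] := xP c cK; rewrite /=; apply/negP => sK; by rewrite (negPf (nKS _ sK)) in sS.
have /maxsetP[/stableP h _] := mS.
by apply: h; [case: (xP c cK)|case: (xP d dK)].
Qed.

(** The maximal clique through a simplicial [s] is the closed neighbourhood of [s], so no outside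
    vertex can be chosen for [s]. *)
Lemma simp_strong K s : maxset (clique e) K -> s \in K -> simp s -> strong_clique e K.
Proof.
move=> /maxsetP[/forall_inP Kc Kmax] sK /simpP ss.
have Ks x : x \in K -> x != s -> e s x.
  by move=> xK xs; move: (Kc _ sK) => /forall_inP/(_ _ xK); rewrite eq_sym xs.
have KE : s |: nbr s = K.
  apply: Kmax.
    apply/forall_inP => x xs; apply/forall_inP => y ys; apply/implyP => xy.
    move: xs ys xy; rewrite !inE => /orP[/eqP->|xs] /orP[/eqP->|ys] xy //.
    - by rewrite eqxx in xy.
    - by rewrite esym.
    - exact: ss.
  by apply/subsetP => x xK; rewrite !inE; have [//|/Ks->] := eqVneq x s.
apply: no_transversal_strong => x [dom _].
by have /andP[sx] := dom _ sK; rewrite -KE !inE sx orbT.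
Qed.

Lemma CIS_no_transversal K x : is_CIS e -> line K -> ~ transversal K x.
Proof.
move=> /forallP/(_ K) cis lK; apply: strong_no_transversal => //.
by apply: (implyP cis); apply: line_maxset.
Qed.

(** In the graph without vertices the empty set is a maximal clique and misses the maximal stable
    set, which is empty too; hence the condition on [T]. A maximal clique that is not a line is an
    isolated vertex, which is simplicial. *)
Lemma CIS_intro : 0 < #|T| -> (forall K x, ns K -> ~ transversal K x) -> is_CIS e.
Proof.
move=> /card_gt0P[t _] h; apply/forallP => K; apply/implyP => mK.
case: (pickP (fun s => (s \in K) && simp s)) => [s /andP[sK ss]|none].
  exact: simp_strong mK sK ss.
apply: no_transversal_strong => x; apply: h.
have nsK : {in K, forall x, ~~ simp x}.
  by move=> s sK; have := none s; rewrite sK /= => ->.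
split => //; apply: maxset_line => //; rewrite ltnNge; apply/negP => K1.
have /maxsetP[_ Kmax] := mK.
have [K0|[c cK]] := set_0Vmem K.
  have K1t : clique e [set t].
    apply/forall_inP => x1 /set1P->; apply/forall_inP => y1 /set1P->.
    by rewrite eqxx.
  have /setP/(_ t) := Kmax _ K1t ltac:(by rewrite K0 sub0set).
  by rewrite K0 !inE eqxx.
have KE : K = [set c].
  by apply/eqP; rewrite eq_sym eqEcard sub1set cK cards1.
case/negP: (nsK c cK); apply/simpP => y z cy _ _; exfalso.
have cyc : clique e [set c; y].
  apply/forall_inP => a /set2P[]->; apply/forall_inP => b /set2P[]->;
  by rewrite ?eqxx ?cy ?implybT // esym cy implybT.
have /setP/(_ y) := Kmax _ cyc ltac:(by rewrite KE sub1set set21).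
by rewrite KE !inE eqxx orbT eq_sym (negPf (e_neq cy)).
Qed.

(** * Lines without simplicial vertices in CIS graphs *)

Lemma cl2P u v : e u v -> (forall y, e u y -> ~~ e v y) <-> #|cl u v| = 2.
Proof.
move=> uv; have s2 : [set u; v] \subset cl u v.
  by apply/subsetP => x /set2P[]->; rewrite ?cl_l ?cl_r.
have c2 : #|[set u; v]| = 2 by rewrite cards2 (e_neq uv).
split => [h|clE y uy].
  rewrite -c2; congr #|pred_of_set _|; apply/eqP; rewrite eq_sym eqEsubset s2 /=.
  apply/subsetP => x; rewrite !inE => /andP[/orP[->//|ux] /orP[->|vx]]; first by rewrite orbT.
  by rewrite (negPf (h _ ux)) in vx.
apply/negP => vy; have := in_cl uy vy.
have /eqP<- : [set u; v] == cl u v by rewrite eqEcard s2 clE c2.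
by rewrite in_set2 => /orP[]/eqP yE; move: uy vy; rewrite yE ?eirr.
Qed.

Lemma cl_set2 u v : e u v -> #|cl u v| = 2 -> cl u v = [set u; v].
Proof.
move=> uv c2; apply/eqP; rewrite eq_sym eqEcard c2 cards2 (e_neq uv) andbT.
by apply/subsetP => x /set2P[]->; rewrite ?cl_l ?cl_r.
Qed.

(** Otherwise [a] and [b] would form a transversal of the two-vertex line. *)
Lemma CIS_edge_complete u v a b : is_CIS e -> e u v -> #|cl u v| = 2 ->
  e u a -> a != v -> e v b -> b != u -> e a b.
Proof.
move=> cis uv c2 ua av vb bu; apply/negPn/negP => nab.
have KE := cl_set2 uv c2; have vu := e_neq uv.
case: (@CIS_no_transversal _ (fun c => if c == u then a else b) cis (line_cl uv)).
rewrite KE; split => [c|c d].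
  rewrite !inE; case: (eqVneq c u) => [-> _|cu /= /eqP->].
    by rewrite ua negb_or av eq_sym (e_neq ua).
  by rewrite vb negb_or bu eq_sym (e_neq vb).
rewrite !inE; case: (eqVneq c u) => _ _ _; case: (eqVneq d u) => _; rewrite ?eirr //.
by rewrite esym.
Qed.

(** A neighbour [b] of [v] off the line sees every neighbour of [u] other than [v]. A triangle on
    [u x] would have an edge seen by both [u] and [b], which is a diamond. So all edges at [u] are
    lines, and [CIS_edge_complete] along [u v] and [u x] gives equal neighbourhoods. *)
Lemma CIS_edge_ns u v x : is_CIS e -> e u v -> ns (cl u v) -> #|cl u v| = 2 ->
  e u x -> [/\ nbr x = nbr v, ns (cl u x) & #|cl u x| = 2].
Proof.
move=> cis uv nsK c2 ux.
have [->//|xv] := eqVneq x v.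
have nvx : ~~ e v x by have /cl2P h := c2; apply: h.
have vu : e v u by rewrite esym.
have xu : e x u by rewrite esym.
have [b vb bK] := ns_outside nsK (cl_r uv).
have bu : b != u by apply: contra bK => /eqP->; rewrite cl_l.
have xb := CIS_edge_complete cis uv c2 ux xv vb bu.
have bNu : ~~ e u b by apply/negP => ub; rewrite in_cl in bK.
have ux2 : #|cl u x| = 2.
  apply/cl2P => // y uy; apply/negP => xy.
  have [yv|yv] := eqVneq y v; first by rewrite -yv esym xy in nvx.
  have yb := CIS_edge_complete cis uv c2 uy yv vb bu.
  case/negP: bNu; apply: (@common_nbrs_adjacent x y) => //; rewrite 1?esym // eq_sym //.
have nsx : ns (cl u x).
  split; first exact: line_cl.
  rewrite cl_set2 // => z /set2P[]->.
    by apply: (@nsimp_intro u v x) => //; rewrite eq_sym.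
  by apply: (@nsimp_intro x u b) => //; rewrite eq_sym.
split => //; apply/setP => y; rewrite !inE; have [->|yu] := eqVneq y u; first by rewrite vu xu.
apply/idP/idP => [xy|vy].
  by apply: (CIS_edge_complete cis ux ux2 uv _ xy yu); rewrite eq_sym.
exact: (CIS_edge_complete cis uv c2 ux xv vy yu).
Qed.

(** * Partial transversals and the equality of line sizes *)

Lemma partial_extend K (J : {set T}) x j y : partial K J x -> j \notin J -> e j y -> y \notin K ->
  (forall i, i \in J -> ~~ e (x i) y) -> partial K (j |: J) (fun c => if c == j then y else x c).
Proof.
move=> [dom sb] jJ jy yK ny; split => [c /setU1P[->|cJ]|c d /setU1P[->|cJ] /setU1P[->|dJ]].
- by rewrite eqxx jy.
- case: eqP => [cj|_]; first by rewrite -cj cJ in jJ.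
  exact: dom.
- by rewrite eqxx eirr.
- rewrite eqxx; case: eqP => [dj|_]; first by rewrite -dj dJ in jJ.
  by rewrite esym ny.
- rewrite eqxx; case: eqP => [dj|_]; first by rewrite -dj cJ in jJ.
  by rewrite ny.
case: eqP => [cj|_]; first by rewrite -cj cJ in jJ.
case: eqP => [dj|_]; first by rewrite -dj dJ in jJ.
exact: sb.
Qed.

Lemma line_outside K j y z : line K -> j \in K -> e j y -> y \notin K ->
  z \in cl j y :\ j -> e j z /\ z \notin K.
Proof.
move=> lK jK jy yK /setD1P[zj zc]; have jz := cl_nbr zc zj; split => //.
have [yz|yz] := eqVneq y z; first by rewrite -yz.
apply/negP => zK; case/negP: yK; have [_ _ mx] := lK.
have [_ adj _] := line_cl jy.
apply: (mx j z) => //; first by rewrite eq_sym.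
by apply: adj => //; [apply: cl_r | rewrite eq_sym].
Qed.

(* Each x i sees at most one vertex of the line through j and y, and none of
   them sees j. *)
Lemma dominated_card K (J : {set T}) x j y : line K -> J \subset K -> j \in K -> j \notin J ->
  partial K J x -> e j y -> y \notin K ->
  (forall z, z \in cl j y :\ j -> [exists i in J, e (x i) z]) ->
  exists2 f : T -> T, {in cl j y :\ j &, injective f} &
    forall z, z \in cl j y :\ j -> f z \in J /\ e (x (f z)) z.
Proof.
move=> lK JK jK jJ [dom _] jy yK dm.
pose f z := odflt j [pick i in J | e (x i) z].
have fP z : z \in cl j y :\ j -> f z \in J /\ e (x (f z)) z.
  move=> zD; rewrite /f; case: pickP => [i /andP[]//|none].
  by have /exists_inP[i iJ iz] := dm z zD; have := none i; rewrite /= iJ iz.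
exists f => // z w zD wD fzw.
have [iJ ez] := fP z zD; have [_ ew] := fP w wD; rewrite -fzw in ew.
have /andP[ix ixK] := dom _ iJ; have lC := line_cl jy.
have nxj : ~~ e j (x (f z)).
  apply: contra ixK => jx; have [_ _ mx] := lK; apply: (mx j (f z)) => //.
    exact: (subsetP JK).
  by apply: contraNneq jJ => ->.
apply: (line_one lC) (_ : x (f z) \notin _) _ _; rewrite 1?esym //.
- by case/setD1P: zD.
- by case/setD1P: wD.
apply: contra nxj => xc; apply: cl_nbr xc _.
by apply: contraNneq ixK => ->.
Qed.

(** A boolean form over finite functions, as the extraction of a minimal set requires. *)
Definition partialb (K J : {set T}) := [exists x : {ffun T -> T},
  [forall c in J, e c (x c) && (x c \notin K)] &&
  [forall c in J, forall d in J, ~~ e (x c) (x d)]].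

Lemma partialbP K J : reflect (exists x, partial K J x) (partialb K J).
Proof.
apply: (iffP existsP) => [[x /andP[/forall_inP dom /forall_inP sb]]|[x [dom sb]]].
  by exists x; split => // c d cJ; apply: (forall_inP (sb c cJ)).
exists [ffun c => x c]; apply/andP; split.
  by apply/forall_inP => c cJ; rewrite ffunE; apply: dom.
by apply/forall_inP => c cJ; apply/forall_inP => d dJ; rewrite !ffunE; apply: sb.
Qed.

Lemma exists_min_nonpartial K : (forall x, ~ partial K K x) ->
  exists2 J : {set T}, J \subset K /\ (forall x, ~ partial K J x) &
    forall j, j \in J -> exists x, partial K (J :\ j) x.
Proof.
move=> np; have : ~~ partialb K K by apply/partialbP => -[x /np].
move=> /(@minset_exists _ (fun J => ~~ partialb K J))[J /minsetP[nJ Jmin] JK].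
exists J; first by split => // x px; case/partialbP: nJ; exists x.
move=> j jJ; apply/partialbP; apply: contraT => nJj.
by have /setP/(_ j) := Jmin _ nJj (subD1set _ _); rewrite !inE eqxx jJ.
Qed.

Lemma partial_dominates K (J : {set T}) x j : (forall x, ~ partial K (j |: J) x) -> partial K J
  x ->
  j \notin J -> forall z, e j z -> z \notin K -> [exists i in J, e (x i) z].
Proof.
move=> np px jJ z jz zK; apply: contraT; rewrite negb_exists_in => /forall_inP nz.
by case: (np _ (partial_extend px jJ jz zK nz)).
Qed.

Lemma CIS_line_size K : is_CIS e -> ns K ->
  forall j y, j \in K -> e j y -> ns (cl j y) /\ #|cl j y| = #|K|.
Proof.
move=> cis; have [m] := ubnP #|K|; elim: m K => // m IH K Km nsK j y jK jy.
have lK := nsK.1; have [K1 adj mx] := lK.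
have [yK|yK] := boolP (y \in K).
  by rewrite -(line_eq lK jK yK (e_neq jy)).
have [k2|k2] := eqVneq #|K| 2.
  have /card_gt1P[a [b [aK bK ab]]] := K1.
  have [w [wK jw]] : exists w, w \in K /\ j != w.
    by have [->|ja] := eqVneq j a; [exists b | exists a].
  have KE := line_eq lK jK wK jw.
  rewrite KE in nsK k2; have [_ nsy ->] := CIS_edge_ns cis (adj _ _ jK wK jw) nsK k2 jy.
  by rewrite KE k2.
have npK x : ~ partial K K x by apply: CIS_no_transversal.
have [J [JK npJ] minJ] := exists_min_nonpartial npK.
have main i z : i \in J -> e i z -> z \notin K -> ns (cl i z) /\ #|cl i z| <= #|J|.
  move=> iJ iz zK; have iK := subsetP JK _ iJ.
  have [x px] := minJ i iJ; have iJ' : i \notin J :\ i by rewrite setD11.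
  have npi x' : ~ partial K (i |: J :\ i) x' by rewrite setD1K.
  have dm := partial_dominates npi px iJ'.
  have dmD w : w \in cl i z :\ i -> [exists l in J :\ i, e (x l) w].
    by move=> wD; have [iw wK] := line_outside lK iK iz zK wD; apply: dm.
  have [f finj fP] := dominated_card lK (subset_trans (subD1set _ _) JK) iK iJ' px iz zK dmD.
  split.
    split; first exact: line_cl.
    move=> w wc; have [->|wi] := eqVneq w i; first exact: nsK.2.
    have wD : w \in cl i z :\ i by rewrite !inE wi; move: wc; rewrite inE.
    have [iw wK] := line_outside lK iK iz zK wD.
    have [/setD1P[fi fJ] ex] := fP w wD.
    have [dom _] := px; have /andP[efx xK] := dom (f w) ltac:(by rewrite !inE fi fJ).
    (* [i] and the dominating vertex [x (f w)] are nonadjacent neighbours of [w]. *)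
    apply: (@nsimp_intro w i (x (f w))); rewrite 1?esym //.
      by apply: contraNneq xK => <-.
    apply: contra fi => ix; apply/eqP; apply: (line_one lK _ iK xK efx); last by rewrite esym.
    exact: (subsetP JK).
  rewrite (cardsD1 i) cl_l //= add1n (cardsD1 i J) iJ ltnS.
  rewrite -(card_in_imset finj); apply/subset_leq_card/subsetP => _ /imsetP[w wD ->].
  by case: (fP w wD).
have JleK := subset_leq_card JK.
have eqk i z : i \in J -> e i z -> z \notin K -> #|cl i z| = #|K|.
  move=> iJ iz zK; have iK := subsetP JK _ iJ; have [nsD Dle] := main i z iJ iz zK.
  have le := leq_trans Dle JleK.
  apply/eqP; rewrite eqn_leq le leqNgt; apply/negP => lt.
  have /card_gt1P[a [b [aK bK ab]]] := K1.
  have [w [wK iw]] : exists w, w \in K /\ i != w.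
    by have [->|ja] := eqVneq i a; [exists b | exists a].
  (* Induction applies to the smaller line through [i], with [K] in the role of the other line. *)
  have [_] := IH _ (leq_trans lt Km) nsD i w (cl_l iz) (adj _ _ iK wK iw).
  by rewrite -(line_eq lK iK wK iw) => kE; rewrite kE ltnn in lt.
(* The empty set has a vacuous choice, so [J] has a member [i]; another line through [i] has #|K|
   vertices, yet at most #|J|. *)
have JE : J = K.
  have [J0|[i iJ]] := set_0Vmem J.
    by case: (npJ id); split => [c|c d]; rewrite J0 inE.
  have [z iz zK] := ns_outside nsK (subsetP JK _ iJ).
  apply/eqP; rewrite eqEcard JK -(eqk i z iJ iz zK).
  by case: (main i z iJ iz zK).
by rewrite -JE in jK; split; [case: (main j y jK jy yK) | apply: eqk].
Qed.
(** Greedy extension: for a missing [i], another line through [i] has #|K| - 1 vertices outside [K],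
    while the at most #|K| - 2 vertices chosen so far block at most one of them each. *)
Lemma partial_complete K (J : {set T}) x j : is_CIS e -> ns K -> j \in K -> J \subset K :\ j ->
  partial K J x -> exists2 x', partial K (K :\ j) x' & {in J, x' =1 x}.
Proof.
move=> cis nsK jK; have lK := nsK.1.
have [m] := ubnP #|(K :\ j) :\: J|; elim: m J x => // m IH J x Jm JK px.
have [J0|[i]] := set_0Vmem ((K :\ j) :\: J).
  exists x => //; suff -> : K :\ j = J by [].
  by apply/eqP; rewrite eqEsubset JK andbT -setD_eq0 J0.
rewrite !inE => /and3P[iJ ij iK].
have [y iy yK] := ns_outside nsK iK.
have [_ kE] := CIS_line_size cis nsK iK iy.
have JK' : J \subset K by apply: subset_trans JK (subD1set _ _).
have [w wD nw] : exists2 w, w \in cl i y :\ i & ~~ [exists c in J, e (x c) w].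
  apply/exists_inP; apply: contraT; rewrite negb_exists_in => /forall_inP h; exfalso.
  have [z zD|f finj fP] := dominated_card lK JK' iK iJ px iy yK; first by have := h z zD;
    rewrite negbK.
  have : #|cl i y :\ i| <= #|J|.
    rewrite -(card_in_imset finj); apply/subset_leq_card/subsetP => _ /imsetP[z zD ->].
    by case: (fP z zD).
  have : #|i |: J| <= #|K :\ j|.
    by apply/subset_leq_card; rewrite subUset sub1set JK andbT !inE ij iK.
  rewrite cardsU1 iJ; have := cardsD1 j K; rewrite jK; have := cardsD1 i (cl i y).
  by rewrite cl_l // kE; lia.
have [iw wK] := line_outside lK iK iy yK wD.
have nwJ c : c \in J -> ~~ e (x c) w.
  by move: nw; rewrite negb_exists_in => /forall_inP; apply.
have [||x' px' x'E] := IH _ _ _ _ (partial_extend px iJ iw wK nwJ).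
- move: Jm; rewrite (cardsD1 i) !inE iJ ij iK /= add1n ltnS; apply: leq_trans.
  rewrite ltnS; apply/subset_leq_card/subsetP => c; rewrite !inE negb_or -!andbA.
  by case/and4P=> -> -> -> ->.
- by rewrite subUset sub1set JK andbT !inE ij iK.
exists x' => // c cJ; rewrite x'E ?inE ?cJ ?orbT //.
by case: eqP => // ci; rewrite -ci cJ in iJ.
Qed.

Lemma outside_nadj K i j y : line K -> i \in K -> j \in K -> i != j -> e i y -> y \notin K ->
  ~~ e j y.
Proof.
by move=> lK iK jK ij iy yK; apply: contra ij => jy; apply/eqP; apply: (line_one lK _ _ yK).
Qed.

(** Domination has no slack here: #|K| - 1 chosen vertices must block all #|K| - 1 vertices of the
    other line, so the assignment is a bijection and every [x i] sees a vertex of that line. *)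
Lemma partial_hits K x j z : is_CIS e -> ns K -> j \in K -> partial K (K :\ j) x ->
  e j z -> z \notin K -> exists f : T -> T,
  forall i, i \in K -> i != j -> exists2 w, w \in cl j z :\ j & f w = i /\ e (x i) w.
Proof.
move=> cis nsK jK px jz zK; have lK := nsK.1.
have np x' : ~ partial K (j |: K :\ j) x'.
  by rewrite setD1K //; apply: CIS_no_transversal.
have jJ : j \notin K :\ j by rewrite setD11.
have dm := partial_dominates np px jJ.
have [w wD|f finj fP] := dominated_card lK (subD1set _ _) jK jJ px jz zK.
  by have [jw wK] := line_outside lK jK jz zK wD; apply: dm.
have fE : f @: (cl j z :\ j) = K :\ j.
  apply/eqP; rewrite eqEcard card_in_imset //; apply/andP; split.
    by apply/subsetP => _ /imsetP[w wD ->]; case: (fP w wD).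
  have := cardsD1 j K; have := cardsD1 j (cl j z); rewrite jK cl_l //.
  by have [_ ->] := CIS_line_size cis nsK jK jz; lia.
exists f => i iK ij.
have : i \in f @: (cl j z :\ j) by rewrite fE !inE ij.
by case/imsetP => w wD ->; exists w => //; case: (fP w wD).
Qed.

(** The single choice of [y] for [i] can be completed on [K] minus [j], and then [partial_hits]
    applies to [y]. *)
Lemma outside_hits K i j y z : is_CIS e -> ns K -> i \in K -> j \in K -> i != j ->
  e i y -> y \notin K -> e j z -> z \notin K -> exists2 w, w \in cl j z :\ j & e y w.
Proof.
move=> cis nsK iK jK ij iy yK jz zK.
have p1 : partial K [set i] (fun=> y).
  by split => [c /set1P->|c d _ _]; rewrite ?iy ?yK ?eirr.
have [|x px xi] := partial_complete cis nsK jK _ p1.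
  by rewrite sub1set !inE ij.
have [f /(_ i iK ij)[w wD [_]]] := partial_hits cis nsK jK px jz zK.
by rewrite xi ?set11 //; exists w.
Qed.

(** If [y] and [y'] were nonadjacent, they would start a partial transversal. Its completion assigns
    them different neighbours on the line through [j] and [z], but each of them sees only [z]
    there. *)
Lemma common_outside K i l j y y' z : is_CIS e -> ns K ->
  i \in K -> l \in K -> j \in K -> i != l -> i != j -> l != j ->
  e i y -> y \notin K -> e l y' -> y' \notin K -> e j z -> z \notin K ->
  e y z -> e y' z -> e y y'.
Proof.
move=> cis nsK iK lK jK il ij lj iy yK ly yK' jz zK yz yz'.
have LK := nsK.1; apply: contraT => nyy.
have p2 : partial K [set i; l] (fun c => if c == i then y else y').
  have li : (l == i) = false by rewrite eq_sym (negPf il).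
  split => [c /set2P[]->|c d /set2P[]-> /set2P[]->];
    rewrite ?eqxx ?li ?iy ?yK ?ly ?yK' ?eirr //.
  by rewrite esym.
have [|x px xi] := partial_complete cis nsK jK _ p2.
  by apply/subsetP => c /set2P[]->; rewrite !inE ?ij ?lj.
have lC := line_cl jz.
have outC u v : u \in K -> u != j -> e u v -> v \notin K -> v \notin cl j z.
  move=> uK uj uv vK; apply: contra (outside_nadj LK uK jK uj uv vK) => vc.
  by apply: cl_nbr vc _; apply: contraNneq vK => ->.
have zC := cl_r jz.
have [f hits] := partial_hits cis nsK jK px jz zK.
have [w /setD1P[_ wC] [fw]] := hits i iK ij.
rewrite xi ?set21 // eqxx => yw.
have [w' /setD1P[_ wC'] [fw']] := hits l lK lj.
rewrite xi ?set22 // eq_sym (negPf il) => yw'.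
have wz : w = z by apply: (line_one lC wC zC (outC _ _ iK ij iy yK)); rewrite esym.
have wz' : w' = z by apply: (line_one lC wC' zC (outC _ _ lK lj ly yK')); rewrite esym.
by rewrite -fw -fw' wz wz' eqxx in il.
Qed.

(** So [j] lies on only one line besides [K]. A vertex [x] outside at [i] sees some [z] and [z'] on
    the lines of [j] through [y] and [y'], and some [w] on a line of [l]. By [common_outside], [w]
    sees [z] and [z'] as well; both are common neighbours of the edge [x w], hence equal or
    adjacent, and the two lines coincide. *)
Lemma outside_clique K j y y' : is_CIS e -> ns K -> 2 < #|K| -> j \in K ->
  e j y -> y \notin K -> e j y' -> y' \notin K -> y != y' -> e y y'.
Proof.
move=> cis nsK K3 jK jy yK jy' yK' yy'; have LK := nsK.1.
have [i [l [iK lK [ij lj il]]]] : exists i l, [/\ i \in K, l \in K & [/\ i != j, l != j & i !=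
  l]].
  have := cardsD1 j K; rewrite jK => KE.
  have /card_gt1P[i [l [/setD1P[ij iK] /setD1P[lj lK] il]]] : 1 < #|K :\ j| by lia.
  by exists i, l.
have [x ix xK] := ns_outside nsK iK; have [t lt tK] := ns_outside nsK lK.
have [w wD xw] := outside_hits cis nsK iK lK il ix xK lt tK.
have [lw wK] := line_outside LK lK lt tK wD.
have [z zD xz] := outside_hits cis nsK iK jK ij ix xK jy yK.
have [z' zD' xz'] := outside_hits cis nsK iK jK ij ix xK jy' yK'.
have [jz zK] := line_outside LK jK jy yK zD; have [jz' zK'] := line_outside LK jK jy' yK' zD'.
have zx : e z x by rewrite esym.
have wx : e w x by rewrite esym.
have zx' : e z' x by rewrite esym.
have [li lj' ji jl] : [/\ l != i, l != j, j != i & j != l] by rewrite lj ![j == _]eq_sym eq_sym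
  il ij lj.
have wz := common_outside cis nsK lK jK iK lj li ji lw wK jz zK ix xK wx zx.
have wz' := common_outside cis nsK lK jK iK lj li ji lw wK jz' zK' ix xK wx zx'.
have jlD := line_cl jy; have [/setD1P[zj zC] /setD1P[zj' zC']] := (zD, zD').
have clE : cl j y = cl j z by apply: (line_eq jlD); rewrite ?cl_l // eq_sym.
have clE' : cl j y' = cl j z' by apply: (line_eq (line_cl jy')); rewrite ?cl_l // eq_sym.
have clzz : cl j z = cl j z'.
  have [->//|zz] := eqVneq z z'.
  apply: (line_eq (line_cl jz)); rewrite ?cl_l // 1?eq_sym //.
  apply: in_cl => //; exact: (common_nbrs_adjacent xw).
have [_ adj _] := jlD; apply: adj => //; first exact: cl_r.
by rewrite clE clzz -clE' cl_r.
Qed.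

Lemma card_outside K j : is_CIS e -> ns K -> 2 < #|K| -> j \in K -> #|nbr j :\: K| = #|K|.-1.
Proof.
move=> cis nsK K3 jK; have [y jy yK] := ns_outside nsK jK.
have [_ <-] := CIS_line_size cis nsK jK jy.
rewrite (cardsD1 j (cl j y)) cl_l //=.
congr #|pred_of_set _|; apply/setP => z; rewrite in_setD in_setD1.
apply/idP/idP => [/andP[zK]|].
  rewrite inE => jz; rewrite eq_sym (e_neq jz) inE jz orbT /=.
  have [//|zy] := eqVneq z y; rewrite /=.
  by apply: (outside_clique cis nsK K3 jK) => //; rewrite eq_sym.
by rewrite -in_setD1 => zD; have [jz ->] := line_outside nsK.1 jK jy yK zD; rewrite inE.
Qed.

(** * The closed neighbourhood of a line *)

Definition around (K : {set T}) := [set x | [exists c in K, (x == c) || e c x]].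

Lemma aroundP (K : {set T}) x : reflect (exists2 c, c \in K & (x == c) || e c x) (x \in around K).
Proof. by rewrite inE; apply: exists_inP. Qed.

Lemma sub_around (K : {set T}) : K \subset around K.
Proof. by apply/subsetP => x xK; apply/aroundP; exists x; rewrite ?eqxx. Qed.

(** No outside vertex is counted twice, since it sees only one vertex of the line. *)
Lemma card_around (K : {set T}) : line K -> #|around K| = #|K| + \sum_(c in K) #|nbr c :\: K|.
Proof.
move=> lK; rewrite -(cardsID K (around K)) (setIidPr (sub_around K)); congr (_ + _).
under eq_bigr => c _ do rewrite -sum1_card.
rewrite (exchange_big_dep (fun x => x \in around K :\: K)) /=; last first.
  move=> c x cK; rewrite !in_setD inE => /andP[-> cx]; apply/aroundP; exists c => //.
  by rewrite cx orbT.
rewrite -sum1_card; apply: eq_bigr => x /setDP[/aroundP[c cK /orP[/eqP xc|cx]] xK].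
  by rewrite xc cK in xK.
rewrite (big_pred1 c) // => d; rewrite !in_setD xK inE /=.
apply/andP/eqP => [[dK dx]|->]; last by [].
exact: (line_one lK dK cK xK dx cx).
Qed.

Lemma card_around_const (K : {set T}) k : line K -> #|K| = k -> (forall c, c \in K -> #|nbr c
  :\: K| = k.-1) ->
  #|around K| = k * k.
Proof.
move=> lK Kk h; rewrite card_around // (eq_bigr (fun=> k.-1)) => [|c cK]; last exact: h.
by rewrite sum_nat_const Kk; case: lK; rewrite Kk; case: k {Kk h} => // k _ _ _; lia.
Qed.

(** For [y] outside [K] at [c], each other [i] in [K] has an outside neighbour [g i] that [y] sees.
    These are #|K| - 1 distinct vertices off [cl c y], and by [card_outside] [y] has no further
    neighbours off that line. *)
Lemma ns_around_closed (K : {set T}) y z : is_CIS e -> ns K -> 2 < #|K| ->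
  y \in around K -> e y z -> z \in around K.
Proof.
move=> cis nsK K3 /aroundP[c cK cy] yz; have lK := nsK.1.
have [yK|yK] := boolP (y \in K); first by apply/aroundP; exists y; rewrite ?yz ?orbT.
have {}cy : e c y by case/orP: cy => // /eqP yc; rewrite yc cK in yK.
have [zC|zC] := boolP (z \in cl c y).
  by apply/aroundP; exists c => //; move: zC; rewrite inE => /andP[].
have [nsC kC] := CIS_line_size cis nsK cK cy.
have kN := @card_outside (cl c y) y cis nsC; rewrite kC (cl_r cy) in kN.
have {}kN := kN K3 isT.
pose g i := odflt y [pick w | [&& e y w, e i w & w \notin K]].
have gP i : i \in K :\ c -> [/\ e y (g i), e i (g i) & g i \notin K].
  move=> /setD1P[ic iK]; rewrite /g; case: pickP => [w /and3P[]//|none].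
  have [t it tK] := ns_outside nsK iK.
  have [|w wD yw] := @outside_hits K c i y t cis nsK cK iK _ cy yK it tK; first by rewrite eq_sym.
  have [iw wK] := line_outside lK iK it tK wD.
  by have := none w; rewrite /= yw iw wK.
have ginj : {in K :\ c &, injective g}.
  move=> i l iJ lJ gil; have [_ ig gK] := gP i iJ; have [_ lg _] := gP l lJ.
  rewrite -gil in lg; apply: (line_one lK _ _ gK ig lg).
    by case/setD1P: iJ.
  by case/setD1P: lJ.
have gE : g @: (K :\ c) = nbr y :\: cl c y.
  apply/eqP; rewrite eqEcard card_in_imset // kN; apply/andP; split.
    apply/subsetP => _ /imsetP[i iJ ->]; have [yg ig gK] := gP i iJ.
    have /setD1P[ic iK] := iJ.
    rewrite in_setD [_ \in nbr y]inE yg andbT;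
      apply: contra (outside_nadj lK iK cK ic ig gK) => gC.
    by apply: cl_nbr gC _; apply: contraNneq gK => ->.
  by have := cardsD1 c K; rewrite cK; lia.
have : z \in nbr y :\: cl c y by rewrite in_setD zC [_ \in nbr y]inE.
rewrite -gE => /imsetP[i iJ ->]; have [_ ig _] := gP i iJ.
by apply/aroundP; exists i; rewrite ?ig ?orbT //; case/setD1P: iJ.
Qed.

Definition near x y := (x == y) || e x y.

(** In the main case [x] and [y] lie outside [K] at different [c] and [d]; then [x] sees a vertex of
    the line through [d] and [y]. *)
Lemma ns_around_diameter (K : {set T}) x y : is_CIS e -> ns K -> 2 < #|K| ->
  x \in around K -> y \in around K -> exists2 z, near x z & near z y.
Proof.
move=> cis nsK K3 /aroundP[c cK cx] /aroundP[d dK dy]; have lK := nsK.1; have [_ adj _] := lK.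
have xc : near x c.
  by case/orP: cx => [/eqP->|cx]; rewrite /near ?eqxx // esym cx orbT.
have [xK|xK] := boolP (x \in K).
  exists d; first by have [->|xd] := eqVneq x d; rewrite /near ?eqxx // adj ?orbT.
  by rewrite /near eq_sym.
have [cd|cd] := eqVneq c d.
  by exists c => //; rewrite /near eq_sym cd.
have {}cx : e c x by case/orP: cx => // /eqP xE; rewrite xE cK in xK.
have [yK|yK] := boolP (y \in K).
  by exists c => //; have [->|cy] := eqVneq c y; rewrite /near ?eqxx // adj ?orbT.
have {}dy : e d y by case/orP: dy => // /eqP yE; rewrite yE dK in yK.
have [w wD xw] := outside_hits cis nsK cK dK cd cx xK dy yK.
have [dw wK] := line_outside lK dK dy yK wD.
exists w; first by rewrite /near xw orbT.
rewrite /near; have [//|wy] := eqVneq w y.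
exact: outside_clique cis nsK K3 dK dw wK dy yK wy.
Qed.

(** * Sufficient conditions against transversals *)

Lemma twin_nbrs_no_transversal (K : {set T}) v p x : line K -> v \in K ->
  (forall u, e v u -> nbr u = nbr p) -> ~ transversal K x.
Proof.
move=> [K1 adj _] vK tw [dom sb].
have [u uK vu] : exists2 u, u \in K & v != u.
  have /card_gt1P[a [b [aK bK ab]]] := K1.
  by have [va|] := eqVneq v a; [exists b; rewrite ?va | exists a].
(* Both [x v] and [u] are neighbours of [v], hence twins; so [x u], a neighbour of [u], is adjacent
   to [x v]. *)
have /andP[vxv _] := dom v vK; have /andP[uxu _] := dom u uK.
have : x u \in nbr (x v) by rewrite (tw _ vxv) -(tw u) ?adj // inE.
by rewrite inE (negPf (sb v u vK uK)).
Qed.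

(** By counting, [around] of any line in [B] is [B]. With [z] chosen for [c], every other chosen
    [x d] therefore sees a vertex of the line through [c] and [z], neither [c] nor, by stability,
    [z]. Two chosen vertices cannot see the same one, since its neighbours off that line form a
    clique. So k - 1 vertices would inject into k - 2. *)
Lemma grid_no_transversal (B : {set T}) k K x c :
  (forall c y, c \in B -> e c y -> y \in B) ->
  (forall K c, line K -> c \in K -> c \in B -> [/\ #|K| = k, #|nbr c :\: K| = k.-1 &
     {in nbr c :\: K &, forall a b, a != b -> e a b}]) ->
  #|B| <= k * k -> line K -> c \in K -> c \in B -> ~ transversal K x.
Proof.
move=> Bcl lines Bk lK cK cB [dom sb].
have KB K' c' : line K' -> c' \in K' -> c' \in B -> {subset K' <= B}.
  move=> [_ adj _] cK' cB' y yK; have [->//|yc] := eqVneq y c'.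
  by apply: Bcl cB' _; apply: adj; rewrite // eq_sym.
have aroundB K' c' : line K' -> c' \in K' -> c' \in B -> around K' = B.
  move=> lK' cK' cB'; have sK := KB _ _ lK' cK' cB'.
  apply/eqP; rewrite eqEcard (card_around_const lK' (k := k)).
  - rewrite Bk andbT; apply/subsetP => y /aroundP[d dK /orP[/eqP->|dy]]; first exact: sK.
    by apply: Bcl dy; apply: sK.
  - by case: (lines _ _ lK' cK' cB').
  - by move=> d dK; case: (lines _ _ lK' dK (sK _ dK)).
have sK := KB _ _ lK cK cB; have [kK _ _] := lines _ _ lK cK cB.
have /andP[cz zK] := dom c cK; set z := x c in cz zK.
have lC := line_cl cz; have [cC zC] := (cl_l cz, cl_r cz).
have [kC _ _] := lines _ _ lC cC cB.
have CB := KB _ _ lC cC cB.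
have hit d : d \in K :\ c -> exists2 y, y \in cl c z :\ c & (y != z) && e y (x d).
  move=> /setD1P[dc dK]; have /andP[dx xK] := dom d dK.
  have : x d \in around (cl c z).
    by rewrite (aroundB _ c) // -(aroundB K c) //; apply/aroundP; exists d; rewrite // dx orbT.
  have ncx : ~~ e c (x d) by apply: outside_nadj lK dK cK dc dx xK.
  case/aroundP => y yC; have [-> /orP[/eqP xc|]|yc] := eqVneq y c.
  - by rewrite xc cK in xK.
  - by rewrite (negPf ncx).
  have cy : e c y by apply: cl_nbr yC _.
  case/orP => [/eqP xy|yx]; first by rewrite xy cy in ncx.
  exists y; first by rewrite in_setD1 yc.
  by rewrite yx andbT; apply: contraTneq yx => ->; apply: sb.
pose g d := odflt z [pick y in cl c z :\ c | (y != z) && e y (x d)].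
have gP d : d \in K :\ c -> g d \in (cl c z :\ c) :\ z /\ e (g d) (x d).
  move=> dJ; rewrite /g; case: pickP => [y /and3P[yC yz yx]|none].
    by rewrite /= yx in_setD1 yz yC.
  by have [y yC yx] := hit d dJ; have := none y; rewrite /= yC yx.
have ginj : {in K :\ c &, injective g}.
  move=> d f dJ fJ gdf; have [gD gd] := gP d dJ; have [_ gf] := gP f fJ; rewrite -gdf in gf.
  have [/setD1P[dc dK] /setD1P[fc fK]] := (dJ, fJ).
  have /andP[dx xK] := dom d dK; have /andP[fx xK'] := dom f fK.
  have /setD1P[gz /setD1P[gc gC]] := gD.
  have out h : h \in K -> h != c -> e h (x h) -> x h \notin K -> x h \notin cl c z.
    move=> hK hc hx hxK; apply: contra (outside_nadj lK hK cK hc hx hxK) => xC.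
    by apply: cl_nbr xC _; apply: contraNneq hxK => ->.
  have [_ _ clq] := lines _ _ lC gC (CB _ gC).
  have [xE|xE] := eqVneq (x d) (x f).
    by rewrite -xE in fx; apply: (line_one lK dK fK xK dx fx).
  have := clq (x d) (x f); rewrite !in_setD !(out d) ?(out f) // !inE gd gf => /(_ isT isT xE).
  by rewrite (negPf (sb _ _ dK fK)).
have : #|K :\ c| <= #|(cl c z :\ c) :\ z|.
  rewrite -(card_in_imset ginj); apply/subset_leq_card/subsetP => _ /imsetP[d dJ ->].
  by case: (gP d dJ).
have := cardsD1 c K; have := cardsD1 c (cl c z); have := cardsD1 z (cl c z :\ c).
rewrite cK cC in_setD1 zC eq_sym (e_neq cz) kK kC /=; have [K1 _ _] := lK.
by rewrite kK in K1; lia.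
Qed.
End DiamondFree.

(** * The decision procedure *)

(* far v is 0 if v is simplicial, and otherwise 1 + some neighbour of v outside
   the line through v and hub v; tf v + 1 and th v + 1 are the sizes of the
   lines of v through hub v and through that neighbour. Each line with a
   simplicial vertex is represented by the largest one (rp), so cov v counts
   the neighbours of v joined to v by such a line, and v is bad iff it lies on
   a line without simplicial vertex. r2 v is the largest vertex within distance
   2 of v; it serves as component label. *)
Section Decision.
Variables (n : nat) (nb : nat -> seq nat).

Definition mc x y : bool := (x == y) || (y \in nb x).
Definition dg v := size (nb v).
Definition hub v := \max_(u <- nb v) u.
Definition far v := foldl (fun a u => if mc (hub v) u then a else u.+1) 0 (nb v).
Definition rp v : bool := (far v == 0) && all (fun u => ~~ ((far u == 0) && (v < u))) (nb v).
Definition cov v := (if rp v then dg v else 0) + \sum_(u <- nb v) (if rp u then dg u else 0).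
Definition tf v := \sum_(u <- nb v) mc (hub v) u.
Definition th v := \sum_(u <- nb v) mc (far v).-1 u.
Definition r1 v := maxn v (\max_(u <- nb v) u).
Definition r2 v := maxn (r1 v) (\max_(u <- nb v) r1 u).
Definition cnt j := \sum_(0 <= x < n) (r2 x == j).
Definition bad v := cov v < dg v.
Definition chk v u :=
  [&& bad u, tf u == tf v &
   if tf v == 1 then (hub u == hub (hub v)) && (dg u == dg (hub v))
   else [&& r2 u == r2 v, th v == tf v, dg v == tf v + tf v
         & cnt (r2 v) == (tf v).+1 * (tf v).+1]].
Definition accept := (0 < n) && all (fun v => bad v ==> all (chk v) (nb v)) (iota 0 n).
End Decision.

(** * Agreement of the tests with the CIS property *)

Section DecisionCorrect.
Variables (n : nat) (e : rel 'I_n) (adj : 'I_n -> seq 'I_n) (nb : nat -> seq nat).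
Hypotheses (esym : symmetric e) (eirr : irreflexive e) (df : diamond_free e).
Hypothesis adjP : adj_lists e adj.
Hypothesis nbE : forall v : 'I_n, nb v = map val (adj v).

Local Notation nbr := (nbr e).
Local Notation cl := (cl e).
Local Notation simp := (simp e).
Local Notation near := (near e).

Lemma mem_nb (v u : 'I_n) : (val u \in nb v) = e v u.
Proof. by rewrite nbE (mem_map val_inj); case: (adjP v). Qed.

Lemma mc_near (u v : 'I_n) : mc nb u v = near u v.
Proof. by rewrite /mc mem_nb. Qed.

Lemma big_nb (R : Type) (idx : R) (op : Monoid.com_law idx) (f : nat -> R) (v : 'I_n) :
  \big[op/idx]_(u <- nb v) f u = \big[op/idx]_(u in nbr v) f u.
Proof.
have [un mem] := adjP v; rewrite nbE big_map big_uniq //.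
by apply: eq_bigl => u; rewrite mem inE.
Qed.

Lemma all_nb (p : pred nat) (v : 'I_n) : all p (nb v) = [forall u in nbr v, p (val u)].
Proof.
rewrite nbE all_map; apply/allP/forall_inP => h u; have [_ mem] := adjP v.
  by rewrite inE -mem => /h.
by rewrite mem => vu; apply: h; rewrite inE.
Qed.

Lemma dgE (v : 'I_n) : dg nb v = #|nbr v|.
Proof. by rewrite /dg -sum1_size (big_nb _ (fun=> 1)) sum1_card. Qed.

Lemma hubP (v u : 'I_n) : e v u -> exists2 f : 'I_n, hub nb v = f & e v f /\ forall w, e v w ->
  w <= f.
Proof.
move=> vu; have le w : e v w -> w <= hub nb v.
  by move=> vw; apply: (@leq_bigmax_seq _ _ _ id); rewrite ?mem_nb.
move: le; rewrite /hub big_nb; have [|f fN ->] := @eq_bigmax_cond _ [pred w | w \in nbr v] val.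
  by apply/card_gt0P; exists u; rewrite !inE.
by exists f => //; split => //; move: fN; rewrite !inE.
Qed.

Lemma farP v : if far nb v == 0 then is_true (all (mc nb (hub nb v)) (nb v))
  else exists2 u, u \in nb v & far nb v = u.+1 /\ ~~ mc nb (hub nb v) u.
Proof.
rewrite /far; set p := mc nb _; elim/last_ind: (nb v) => // s u IH.
rewrite -cats1 foldl_cat all_cat /= andbT; case pu: (p u); rewrite ?andbT ?andbF /=.
  case: ifP IH => // _ [w ws wE]; exists w => //; by rewrite mem_cat ws.
by exists u; rewrite ?mem_cat ?inE ?eqxx ?orbT ?pu.
Qed.

(** Testing against one neighbour suffices: the neighbours of [v] that see [hub v] are common
    neighbours of an edge, hence pairwise adjacent. *)
Lemma far0 (v : 'I_n) : (far nb v == 0) = simp v.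
Proof.
have := farP v; case: eqP => [far0|_] h; symmetry.
  apply/(simpP e v) => x y vx vy xy; have [f fE [vf _]] := hubP vx.
  move: h; rewrite fE all_nb => /forall_inP h.
  have := h x; have := h y; rewrite !inE !mc_near => /(_ vy) fy /(_ vx) fx.
  case/orP: fx => [/eqP fx|fx].
    case/orP: fy => [/eqP fy|]; last by rewrite -fx.
    by rewrite -fx -fy eqxx in xy.
  case/orP: fy => [/eqP fy|fy]; first by rewrite -fy esym; apply: fx.
  exact: (common_nbrs_adjacent eirr df vf).
case: h => u; rewrite {1}nbE => /mapP[w wv ->] [_]; have [_ mem] := adjP v.
rewrite mem in wv; have [f fE [vf _]] := hubP wv.
rewrite fE mc_near negb_or => /andP[fw nfw]; apply/negbTE.
exact: (nsimp_intro vf wv fw nfw).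
Qed.

Lemma farSP (v : 'I_n) : ~~ simp v ->
  exists h f : 'I_n, [/\ far nb v = h.+1, hub nb v = f, e v h, e v f & ~~ near f h].
Proof.
rewrite -far0; have := farP v; case: eqP => // _ [u]; rewrite {1}nbE.
case/mapP=> h hv -> [fE]; have [_ mem] := adjP v; rewrite mem in hv.
by have [f hE [vf _]] := hubP hv; rewrite hE mc_near => nfh _; exists h, f.
Qed.

Lemma rpE (v : 'I_n) : rp nb v = simp v && [forall u in nbr v, ~~ (simp u && (v < u))].
Proof.
by rewrite /rp far0 all_nb; congr (_ && _); apply: eq_forallb => u; rewrite far0.
Qed.

Lemma covE (v : 'I_n) : cov nb v = \sum_(u in v |: nbr v | rp nb u) #|nbr u|.
Proof.
rewrite big_mkcondr big_setU1 /=; last by rewrite inE eirr.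
by rewrite /cov (big_nb _ (fun u => if rp nb u then dg nb u else 0)) dgE; congr (_ + _);
  apply: eq_bigr => u _; rewrite dgE.
Qed.

Lemma simp_nbhd s u v : simp s -> e u v -> s \in cl u v -> s |: nbr s = cl u v.
Proof.
move=> /simpP ss uv sC; have lC := line_cl esym eirr df uv.
apply/setP => x; apply/idP/idP => [/setU1P[->//|]|xC]; last first.
  rewrite !inE; have [//|xs] := eqVneq x s; have [_ adjK _] := lC.
  by apply: adjK; rewrite // eq_sym.
rewrite inE => sx; have [_ adjC mx] := lC.
have [w wC sw] : exists2 w, w \in cl u v & s != w.
  have [su|] := eqVneq s u; last by exists u; rewrite ?cl_l.
  by exists v; rewrite ?cl_r // su (e_neq eirr uv).
have [->//|xw] := eqVneq x w.
apply: (mx s w) => //; apply: ss => //; last by rewrite eq_sym.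
exact: adjC.
Qed.

(* Each simplicial line is counted at its largest simplicial vertex. *)
Lemma rp_count (v x : 'I_n) : e v x ->
  \sum_(u in cl v x | rp nb u) 1 = [exists s in cl v x, simp s].
Proof.
move=> vx; case: (pickP (fun s => (s \in cl v x) && simp s)) => [s0 s0P|none]; last first.
  rewrite (_ : [exists s in _, _] = false); last first.
    by apply/negbTE; rewrite negb_exists; apply/forallP => s; rewrite none.
  by rewrite big_pred0 // => u; rewrite rpE andbA none.
have -> : [exists s in cl v x, simp s] by apply/existsP; exists s0.
have [s /andP[sC ss] smax] := @arg_maxnP _ s0 (fun s => (s \in cl v x) && simp s) val s0P.
have [_ adjK _] := line_cl esym eirr df vx.
rewrite (big_pred1 s) // => u /=; rewrite rpE; apply/idP/eqP => [/and3P[uC us /forall_inP um]|->].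
  apply/eqP; apply: contraT => ne; have := um s; rewrite inE adjK // ss /= => /(_ isT).
  by rewrite -leqNgt => su; have := smax u; rewrite uC us /= => /(_ isT) us'; case/eqP: ne;
    apply/val_inj/eqP; rewrite eqn_leq su us'.
rewrite sC ss /=; apply/forall_inP => w; rewrite inE => sw; apply/negP => /andP[ws lt].
have wC : w \in cl v x by rewrite -(simp_nbhd ss vx sC) !inE sw orbT.
by have := smax w; rewrite wC ws /= => /(_ isT); rewrite leqNgt lt.
Qed.

(** Double counting of pairs of a representative [u] and a neighbour [x] of [v] on its line. The
    degree of a simplicial [u] is the size of its line minus one, which is also the number of
    neighbours of [v] on that line. *)
Lemma cov_count (v : 'I_n) : cov nb v = \sum_(x in nbr v) [exists s in cl v x, simp s].
Proof.
rewrite covE.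
transitivity (\sum_(u in v |: nbr v | rp nb u) \sum_(x in nbr v | u \in cl v x) 1).
  apply: eq_bigr => u /andP[uv]; rewrite rpE => /andP[us _].
  rewrite sum1dep_card; case/setU1P: uv => [->|].
    congr #|pred_of_set _|; apply/setP => x; rewrite !inE.
    by apply/idP/andP => [vx|[]//]; rewrite vx eqxx esym vx orbT.
  rewrite inE => vu; have uv : e u v by rewrite esym.
  (* Both sides are the line of [u], seen once from [v] and once from [u]. *)
  have SE : v |: [set x in nbr v | u \in cl v x] = u |: nbr u.
    apply/setP => x; rewrite !inE; have [->|xv] /= := eqVneq x v; first by rewrite uv orbT.
    rewrite vu orbT /= (eq_sym u x) (esym x u); have [->|xu] /= := eqVneq x u;
      first by rewrite vu.
    rewrite andb_idl // => ux; rewrite esym; apply: (simpP _ _ us) => //.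
  have := congr1 (fun A : {set _} => #|A|) SE.
  by rewrite !cardsU1 !inE !eirr /=; lia.
rewrite (exchange_big_dep (fun x => x \in nbr v)) /=; last by move=> u x _ /andP[].
apply: eq_bigr => x; rewrite inE => vx; rewrite -rp_count //.
apply: eq_bigl => u; rewrite vx /=.
rewrite andbAC; congr (_ && _); apply/andP/idP => [[]//|uC]; split => //.
by rewrite !inE in uC *; case/andP: uC.
Qed.

Lemma badP (v : 'I_n) : reflect (exists2 u, e v u & ns e (cl v u)) (bad nb v).
Proof.
rewrite /bad cov_count dgE -sum1_card.
apply: (iffP idP) => [|[u vu [_ nsK]]].
  move=> lt; have [x /andP[vx nx]|all] := pickP (fun x =>
    (x \in nbr v) && ~~ [exists s in cl v x, simp s]).
    exists x; first by move: vx; rewrite inE.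
    rewrite inE in vx; split; first exact: line_cl.
    by move=> s sC; apply: contra nx => ss; apply/existsP; exists s; rewrite sC.
  move: lt; rewrite ltnNge; case/negP; apply: leq_sum => x xN.
  by have := all x; rewrite xN /= => /negbFE ->.
rewrite (bigD1 u) ?inE //= [X in _ < X](bigD1 u) ?inE //=.
have /negbTE-> : ~~ [exists s in cl v u, simp s].
  by rewrite negb_exists; apply/forallP => s; apply/negP => /andP[sC]; apply/negP/nsK.
by rewrite add0n add1n ltnS; apply: leq_sum => x _; case: [exists s in cl v x, simp s].
Qed.

(** The sum runs over the neighbours of [v] and so misses exactly [v]; [f] itself is counted because
    [mc] is reflexive. *)
Lemma card_cl (v f : 'I_n) : e v f -> (\sum_(u <- nb v) mc nb f u).+1 = #|cl v f|.
Proof.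
move=> vf; rewrite (big_nb _ (fun u => mc nb f u : nat)) (cardsD1 v) cl_l // add1n; congr _.+1.
rewrite -sum1_card big_mkcond [RHS]big_mkcond; apply: eq_bigr => u _.
rewrite mc_near !inE; have [->|uv] /= := eqVneq u v; first by rewrite eirr.
by case: (e v u) => //=; rewrite /near eq_sym; case: (_ || _).
Qed.

Lemma tfE (v f : 'I_n) : e v f -> hub nb v = f -> (tf nb v).+1 = #|cl v f|.
Proof. by move=> vf hE; rewrite /tf hE card_cl. Qed.

Lemma thE (v h : 'I_n) : e v h -> far nb v = h.+1 -> (th nb v).+1 = #|cl v h|.
Proof. by move=> vf hE; rewrite /th hE card_cl. Qed.

Lemma nearC (x y : 'I_n) : near x y = near y x.
Proof. by rewrite /near eq_sym esym. Qed.

Lemma nearxx (x : 'I_n) : near x x.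
Proof. by rewrite /near eqxx. Qed.

Lemma r1_ub (v x : 'I_n) : near v x -> x <= r1 nb v.
Proof.
rewrite /r1 leq_max => /orP[/eqP->|vx]; first by rewrite leqnn.
by apply/orP; right; apply: (@leq_bigmax_seq _ _ _ id); rewrite ?mem_nb.
Qed.

Lemma r2_ub (v z x : 'I_n) : near v z -> near z x -> x <= r2 nb v.
Proof.
move=> vz zx; apply: leq_trans (r1_ub zx) _; rewrite /r2 leq_max.
case/orP: vz => [/eqP->|vz]; first by rewrite leqnn.
by apply/orP; right; apply: leq_bigmax_seq; rewrite ?mem_nb.
Qed.

Lemma max_nbhd (f : nat -> nat) (v : 'I_n) :
  exists2 x : 'I_n, near v x & maxn (f v) (\max_(u <- nb v) f u) = f x.
Proof.
rewrite big_nb; have [le|lt] := leqP (\max_(u in nbr v) f u) (f v).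
  by exists v; rewrite ?nearxx.
have [|u vu uE] := @eq_bigmax_cond _ [pred w | w \in nbr v] (f \o val).
  rewrite lt0n; apply: contraTneq lt => N0; rewrite -leqNgt big_pred0 // => u.
  by have /card0_eq/(_ u) := N0; rewrite !inE.
exists u; first by rewrite /near; move: vu; rewrite !inE => ->; rewrite orbT.
exact: uE.
Qed.

Lemma r2P (v : 'I_n) : exists x z : 'I_n, [/\ near v z, near z x & r2 nb v = x].
Proof.
have [z vz zE] := max_nbhd (r1 nb) v; have [x zx xE] := max_nbhd id z.
by exists x, z; split => //; rewrite /r2 zE.
Qed.

Lemma cntE j : cnt n nb j = #|[set x : 'I_n | r2 nb x == j]|.
Proof.
rewrite /cnt big_mkord -sum1_card big_mkcond [RHS]big_mkcond.
by apply: eq_bigr => x _; rewrite inE; case: eqP.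
Qed.

Lemma acceptP : reflect (0 < n /\ forall v u : 'I_n, bad nb v -> e v u -> chk n nb v u) (accept
  n nb).
Proof.
apply: (iffP andP) => -[n0 h]; split => //.
  move=> v u bv vu; move/allP: h => /(_ (val v)); rewrite mem_iota ltn_ord => /(_ isT).
  by rewrite bv /= => /allP/(_ (val u)); rewrite mem_nb; apply.
apply/allP => v; rewrite mem_iota /= add0n => vn; apply/implyP => bv.
have -> : v = val (Ordinal vn) by [].
by rewrite all_nb; apply/forall_inP => u; rewrite inE; apply: h.
Qed.

Lemma nbr_eq_hub (v w : 'I_n) : nbr v = nbr w -> hub nb v = hub nb w.
Proof. by move=> E; rewrite /hub !big_nb E. Qed.

Lemma nbr_eq_dg (v w : 'I_n) : nbr v = nbr w -> dg nb v = dg nb w.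
Proof. by move=> E; rewrite !dgE E. Qed.

(** The lines through [f] and [h] meet only in [c], so together they already contain 2(k - 1)
    neighbours of [c]. *)
Lemma two_lines (c f h : 'I_n) k : e c f -> e c h -> ~~ near f h ->
  #|cl c f| = k -> #|cl c h| = k -> #|nbr c| = k.-1 + k.-1 ->
  nbr c = (cl c f :\ c) :|: (cl c h :\ c) /\ nbr c :\: cl c f = cl c h :\ c.
Proof.
move=> cf ch fh kf kh kN.
have disj : [disjoint cl c f :\ c & cl c h :\ c].
  rewrite -setI_eq0; apply/set0Pn => -[x /setIP[/setD1P[xc xf] /setD1P[_ xh]]].
  have lf := line_cl esym eirr df cf; have lh := line_cl esym eirr df ch.
  have clfh : cl c f = cl c h.
    rewrite (line_eq lf (cl_l esym cf) xf) 1?eq_sym //.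
    by rewrite -(line_eq lh (cl_l esym ch) xh) // eq_sym.
  case/negP: fh; have := cl_r esym ch; rewrite -clfh inE => /andP[_].
  by rewrite /near eq_sym.
have NE : nbr c = (cl c f :\ c) :|: (cl c h :\ c).
  apply/eqP; rewrite eq_sym eqEcard; apply/andP; split.
    apply/subsetP => x /setUP[]/setD1P[xc xC]; rewrite inE; exact: cl_nbr xC xc.
  rewrite cardsU disjoint_setI0 // cards0 subn0 kN.
  have := cardsD1 c (cl c f); have := cardsD1 c (cl c h); rewrite !cl_l // kf kh; lia.
split => //; rewrite {1}NE setDUl (_ : _ :\: _ = set0) ?set0U; last first.
  by apply/eqP; rewrite setD_eq0 subD1set.
apply/setDidPl; rewrite disjoint_sym.
rewrite -setI_eq0 -subset0; apply/subsetP => x /setIP[xf xh].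
have : x \in (cl c f :\ c) :&: (cl c h :\ c).
  by rewrite inE xh andbT !inE; case/setD1P: xh => -> _; move: xf; rewrite inE => ->.
by rewrite disjoint_setI0.
Qed.

(** Every edge at [c] lies on one of its two lines, so [K] is one of them and the remaining
    neighbours form the other. *)
Lemma grid_lines (K : {set 'I_n}) (c : 'I_n) k : line e K -> c \in K -> ~~ simp c ->
  (tf nb c).+1 = k -> th nb c = tf nb c -> dg nb c = tf nb c + tf nb c ->
  [/\ #|K| = k, #|nbr c :\: K| = k.-1 & {in nbr c :\: K &, forall a b, a != b -> e a b}].
Proof.
move=> lK cK ns tk thE' dgE'; have [h [f [farE hubE ch cf fh]]] := farSP ns.
have kf := tfE cf hubE; have kh := thE ch farE; rewrite thE' tk in kh; rewrite tk in kf.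
have kN : #|nbr c| = k.-1 + k.-1 by rewrite -dgE dgE' -tk.
have [NE Nf] := two_lines cf ch fh (Logic.eq_sym kf) (Logic.eq_sym kh) kN.
rewrite nearC in fh; have [_ Nh] := two_lines ch cf fh (Logic.eq_sym kh) (Logic.eq_sym kf) kN.
have [a aK ca] : exists2 a, a \in K & c != a.
  have [/card_gt1P[a [b [aK bK ab]]] _ _] := lK.
  by have [ca|] := eqVneq c a; [exists b; rewrite ?ca | exists a].
have [_ adjK _] := lK; have cNa : a \in nbr c by rewrite inE adjK.
have clique z : e c z -> {in cl c z :\ c &, forall a b, a != b -> e a b}.
  move=> cz x y /setD1P[_ xz] /setD1P[_ yz].
  by have [_ adjz _] := line_cl esym eirr df cz; apply: adjz.
have size z : e c z -> k = #|cl c z| -> #|cl c z :\ c| = k.-1.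
  by move=> cz ->; rewrite (cardsD1 c (cl c z)) cl_l.
have KE z : e c z -> a \in cl c z -> K = cl c z.
  move=> cz az; rewrite (line_eq lK cK aK ca); symmetry; apply: line_eq => //.
    exact: line_cl.
  exact: cl_l.
rewrite NE in cNa; case/setUP: cNa => /setD1P[_ aC].
  by rewrite (KE f cf aC) Nf; split; rewrite ?size //; apply: clique.
by rewrite (KE h ch aC) Nh; split; rewrite ?size //; apply: clique.
Qed.

Lemma accept_CIS : accept n nb -> is_CIS e.
Proof.
case/acceptP => n0 chkP; apply: CIS_intro => //; first by rewrite card_ord.
move=> K x nsK; have lK := nsK.1.
have [c [a [cK aK ca]]] : exists c a, [/\ c \in K, a \in K & c != a].
  by have [/card_gt1P[c [a [? ? ?]]] _ _] := lK; exists c, a.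
have [_ adjK _] := lK; have eca := adjK _ _ cK aK ca.
have bc : bad nb c by apply/badP; exists a; rewrite // -(line_eq lK cK aK ca).
have [f fE [cf _]] := hubP eca.
have [t1|t1] := eqVneq (tf nb c) 1.
  apply: (@twin_nbrs_no_transversal _ _ K c f) => // u cu.
  have uc : e u c by rewrite esym.
  have fc : e f c by rewrite esym.
  have /and3P[bu tu] := chkP _ _ bc cu; rewrite t1 eqxx => /andP[/eqP hu /eqP du].
  rewrite fE in hu du.
  (* A neighbour [y] of [u] and [c], which is one too, are both compared with [hub u]; so they have
     the same largest neighbour [f], and [f] sees [y]. Equal degrees then turn the inclusion into an
     equality. *)
  have sub : nbr u \subset nbr f.
    apply/subsetP => y; rewrite !inE => uy.
    have /and3P[_ _] := chkP _ _ bu uy; rewrite (eqP tu) t1 eqxx => /andP[/eqP hy _].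
    have /and3P[_ _] := chkP _ _ bu uc; rewrite (eqP tu) t1 eqxx => /andP[/eqP hc _].
    have yu : e y u by rewrite esym.
    have [g gE [yg _]] := hubP yu.
    have gf : g = f by apply: val_inj; rewrite /= -fE -gE hy hc.
    by rewrite esym -gf.
  by apply/eqP; rewrite eqEcard sub -!dgE du leqnn.
set k := (tf nb c).+1.
(* The checks hand badness, size and label on to neighbours, so [B] is closed under adjacency; [cnt]
   bounds its size by k^2. *)
pose B := [set y : 'I_n | [&& bad nb y, tf nb y == tf nb c & r2 nb y == r2 nb c]].
have Bchk y z : y \in B -> e y z ->
    [&& bad nb z, tf nb z == tf nb y, r2 nb z == r2 nb y, th nb y == tf nb y & dg nb y == tf nb
      y + tf nb y].
  rewrite inE => /and3P[by_ /eqP ty _] yz; have := chkP _ _ by_ yz.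
  by rewrite /chk ty (negPf t1) => /and5P[-> -> -> -> /andP[-> _]].
apply: (@grid_no_transversal _ _ esym eirr df B k K x c) => //.
- move=> y z yB yz; have /and5P[bz /eqP tz /eqP rz _ _] := Bchk _ _ yB yz.
  by move: yB; rewrite !inE bz tz rz => /and3P[_ -> ->].
- move=> K' y lK' yK' yB; have yb : bad nb y by move: yB; rewrite inE => /and3P[].
  have /badP[u yu [_ nsy]] := yb.
  have /and5P[_ _ _ /eqP ty /eqP dy] := Bchk _ _ yB yu.
  apply: grid_lines => //; first by apply: nsy; apply: cl_l.
  by move: yB; rewrite inE => /and3P[_ /eqP-> _].
- have /and3P[_ _] := chkP _ _ bc eca; rewrite (negPf t1) => /and4P[_ _ _ /eqP <-].
  rewrite cntE; apply/subset_leq_card/subsetP => y; rewrite !inE.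
  by case/and3P.
by rewrite inE bc !eqxx.
Qed.

Lemma CIS_accept : is_CIS e -> accept n nb.
Proof.
move=> cis; apply/acceptP; split.
  rewrite lt0n; apply/negP => /eqP n0.
  have E (A B : {set 'I_n}) : A = B.
    by apply/setP => i; have := ltn_ord i; rewrite {2}n0.
  have mx (P : pred {set 'I_n}) : P set0 -> maxset P set0.
    by move=> P0; apply/maxsetP; split => // B _ _; apply: E.
  have /forallP/(_ set0)/implyP st : strong_clique e set0.
    by apply: (implyP (forallP cis set0)); apply: mx; apply/forall_inP => i; rewrite inE.
  have := st (mx _ _); rewrite setI0 eqxx => /(_ _)/negP; apply => //.
  by apply/forall_inP => i; rewrite inE.
move=> v u /badP[a va nsK] vu.
have uv : e u v by rewrite esym.
have [f fE [vf _]] := hubP va.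
have sz y z : y \in cl v a -> e y z -> ns e (cl y z) /\ #|cl y z| = #|cl v a|.
  by move=> yK yz; apply: CIS_line_size.
have vK := cl_l esym va.
have [nsu ku] := sz v u vK vu; have [nsf kf] := sz v f vK vf.
have bu : bad nb u by apply/badP; exists v => //; rewrite clC.
have [g gE [ug _]] := hubP uv.
have [nsg kg] : ns e (cl u g) /\ #|cl u g| = #|cl v u|.
  by apply: CIS_line_size => //; apply: cl_r.
have tE : tf nb u = tf nb v by apply: succn_inj; rewrite (tfE ug gE) (tfE vf fE) kg ku kf.
have tK : (tf nb v).+1 = #|cl v a| by rewrite (tfE vf fE).
rewrite /chk bu tE eqxx /=; case: eqVneq => [t1|t1].
  rewrite t1 in tK.
  have tw w : e v w -> nbr w = nbr a.
    by move=> vw; have [] := CIS_edge_ns esym eirr df cis va nsK (Logic.eq_sym tK) vw.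
  rewrite fE; apply/andP; split; apply/eqP.
    by apply: nbr_eq_hub; rewrite !tw.
  by apply: nbr_eq_dg; rewrite !tw.
have K3 : 2 < #|cl v a|.
  by have [[K1 _ _] _] := nsK; move: t1 K1; rewrite -tK; lia.
set K := cl v a in K3 tK nsK sz vK.
have lK := nsK.1; have [K1 adjK _] := lK.
have cl1 y z : y \in around e K -> e y z -> z \in around e K.
  exact: ns_around_closed.
(* The label of a vertex is reached along edges and [around K] is closed under adjacency, so a
   vertex lies in [around K] iff its label does. *)
have r2_in y : (y \in around e K) = [exists z : 'I_n, (z \in around e K) && (r2 nb y == z)].
  have nr t z : near t z -> t \in around e K -> z \in around e K.
    by case/orP => [/eqP->//|tz tA]; apply: (cl1 _ _ _ tz).
  have [m [z [yz zm rE]]] := r2P y.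
  apply/idP/existsP => [yA|[w /andP[wA /eqP wE]]].
    by exists m; rewrite rE eqxx andbT; apply: (nr _ _ zm); apply: (nr _ _ yz).
  have wm : w = m by apply: val_inj; rewrite /= -wE -rE.
  rewrite nearC in yz; rewrite nearC in zm.
  by apply: (nr _ _ yz); apply: (nr _ _ zm); rewrite -wm.
(* The label of [y] lies in [around K], hence within distance two of [z]; used in both directions
   this makes the label constant. *)
have r2_const y z : y \in around e K -> z \in around e K -> r2 nb y <= r2 nb z.
  move=> yA zA; have [m [t [yt tm ->]]] := r2P y.
  have mA : m \in around e K.
    case/orP: tm => [/eqP<-|tm]; last apply: (cl1 _ _ _ tm).
      by case/orP: yt => [/eqP<-//|]; apply: (cl1 _ _).
    by case/orP: yt => [/eqP<-//|]; apply: (cl1 _ _).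
  have [w zw wm] := ns_around_diameter esym eirr df cis nsK K3 zA mA.
  exact: r2_ub zw wm.
have vA : v \in around e K by apply: (subsetP (sub_around _ _)).
have uA : u \in around e K by apply: (cl1 _ _ _ vu).
have nsv : ~~ simp v by have [_ h] := nsK; apply: h.
have [h [f' [farE _ vh _ _]]] := farSP nsv.
have [_ kh] := sz v h vK vh.
apply/and4P; split.
- by rewrite eqn_leq !r2_const.
- by apply/eqP/succn_inj; rewrite (thE vh farE) kh tK.
- rewrite dgE -(cardsID K) (card_outside esym eirr df cis nsK K3 vK).
  have -> : nbr v :&: K = K :\ v.
    apply/setP => y; rewrite in_setI in_setD1 inE andbC; have [yK|] := boolP (y \in K);
      rewrite ?andbF //=.
    have [->|yv] := eqVneq y v; first by rewrite eirr.
    by rewrite adjK // eq_sym.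
  by have := cardsD1 v K; rewrite vK -tK add1n => -[<-].
rewrite cntE tK -(card_around_const lK (erefl _)) => [|y yK]; last exact: card_outside.
apply/eqP; congr #|pred_of_set _|; apply/setP => y; rewrite [LHS]inE.
apply/eqP/idP => [rE|yA]; last by apply/eqP; rewrite eqn_leq !r2_const.
by rewrite r2_in rE -r2_in.
Qed.

Lemma accept_correct : accept n nb = is_CIS e.
Proof. by apply/idP/idP; [apply: accept_CIS | apply: CIS_accept]. Qed.
End DecisionCorrect.

(** * A loop language compiled to the RAM *)

Definition code_at (P : program) (o : nat) (code : program) :=
  exists pre post, P = pre ++ code ++ post /\ size pre = o.

Lemma code_at_cat P o a b : code_at P o (a ++ b) -> code_at P o a /\ code_at P (o + size a) b.
Proof.
move=> [pre [post [-> <-]]]; split; first by exists pre, (b ++ post); rewrite -!catA.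
exists (pre ++ a), post; split; last exact: size_cat.
by rewrite !catA.
Qed.

Lemma code_at_cons P o i c : code_at P o (i :: c) -> code_at P o.+1 c.
Proof. by move=> /(@code_at_cat P o [:: i])[_]; rewrite addn1. Qed.

Arguments run : simpl never.

Lemma run_add P a b s : run P (a + b) s = run P b (run P a s).
Proof. by rewrite /run addnC iterD. Qed.

Definition exec_instr (i : instr) (p : nat) (m : nat -> nat) : state :=
  match i with
  | IConst i c => State p.+1 (upd m i c)
  | IAdd i j k => State p.+1 (upd m i (m j + m k))
  | ISub i j k => State p.+1 (upd m i (m j - m k))
  | ILoad i j => State p.+1 (upd m i (m (m j)))
  | IStore i j => State p.+1 (upd m (m i) (m j))
  | IJz i l => State (if m i == 0 then l else p.+1) m
  | IJmp l => State l m
  end.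

Lemma run1 P o i c m : code_at P o (i :: c) -> run P 1 (State o m) = exec_instr i o m.
Proof.
move=> [pre [post [-> <-]]]; rewrite /run /= /halted /= !size_cat /= addnS ltnNge leq_addr /=.
by rewrite /step /= nth_cat ltnn subnn /=.
Qed.

Definition jumpfree (i : instr) := if i is (IJz _ _ | IJmp _) then false else true.
Definition effect (m : nat -> nat) (i : instr) := Defs.mem (exec_instr i 0 m).

Lemma run_jumpfree P o code m : all jumpfree code -> code_at P o code ->
  run P (size code) (State o m) = State (o + size code) (foldl effect m code).
Proof.
elim: code o m => [|i code IH] o m /=; first by rewrite addn0.
move=> /andP[ji jc] cat; rewrite -add1n run_add (run1 _ cat).
have [_] := @code_at_cat P o [:: i] code cat; rewrite addn1 => catc.
have -> : exec_instr i o m = State o.+1 (effect m i) by case: i ji {cat}.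
by rewrite IH // addSnnS.
Qed.

Inductive op :=
| OConst of nat & nat
| OAdd of nat & nat & nat
| OSub of nat & nat & nat
| ORead of nat & nat & nat
| OWrite of nat & nat & nat.

(** [Rep r c] runs [c] as often as [r] says on entry, whatever the body does to [r]; so every
    command terminates and has an exact cost. *)
Inductive cmd :=
| Skip
| Op of op
| Seq of cmd & cmd
| IfZ of nat & cmd & cmd
| Rep of nat & cmd.

Record st := St { reg : nat -> nat; arr : nat -> nat -> nat }.

Definition upd_arr (A : nat -> nat -> nat) a i v : nat -> nat -> nat :=
  fun a' i' => if (a' == a) && (i' == i) then v else A a' i'.

Definition eval_op (o : op) (s : st) : st :=
  let: St R A := s in
  match o with
  | OConst r c => St (upd R r c) A
  | OAdd r j k => St (upd R r (R j + R k)) A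
  | OSub r j k => St (upd R r (R j - R k)) A
  | ORead r a i => St (upd R r (A a (R i))) A
  | OWrite a i r => St R (upd_arr A a (R i) (R r))
  end.

Fixpoint eval (c : cmd) (s : st) : st :=
  match c with
  | Skip => s
  | Op o => eval_op o s
  | Seq c1 c2 => eval c2 (eval c1 s)
  | IfZ r c1 c2 => if reg s r == 0 then eval c1 s else eval c2 s
  | Rep r c1 => iter (reg s r) (eval c1) s
  end.

(* Memory layout: cells 0-11 are the registers of the language, 12 holds the
   base address of the arrays, 13 and 14 are address scratch, 15 and 16 are the
   loop counters (one per nesting depth), and 17 holds the constant 1. Cell i
   of array a < 32 lies at base + 32 i + a. *)
Definition address_code a i :=
  [:: IAdd 13 i i; IAdd 13 13 13; IAdd 13 13 13; IAdd 13 13 13; IAdd 13 13 13;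
      IConst 14 a; IAdd 13 13 14; IAdd 13 13 12].

Arguments address_code : simpl never.

Definition op_code (o : op) : program :=
  match o with
  | OConst r c => [:: IConst r c]
  | OAdd r j k => [:: IAdd r j k]
  | OSub r j k => [:: ISub r j k]
  | ORead r a i => rcons (address_code a i) (ILoad r 13)
  | OWrite a i r => rcons (address_code a i) (IStore 13 r)
  end.

Fixpoint csize (c : cmd) : nat :=
  match c with
  | Skip => 0
  | Op o => size (op_code o)
  | Seq c1 c2 => csize c1 + csize c2
  | IfZ _ c1 c2 => csize c1 + csize c2 + 2
  | Rep _ c1 => csize c1 + 5
  end.

(** Jumps are absolute, so the start address [o] is needed; the loop depth [d] selects the counter
    cell. The zero branch of [IfZ] comes last, behind a jump that ends the other branch. *)
Fixpoint compile (o d : nat) (c : cmd) : program :=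
  match c with
  | Skip => [::]
  | Op h => op_code h
  | Seq c1 c2 => compile o d c1 ++ compile (o + csize c1) d c2
  | IfZ r c1 c2 =>
      [:: IJz r (o + (csize c2 + 2))] ++ compile o.+1 d c2
      ++ [:: IJmp (o + (csize c1 + csize c2 + 2))]
      ++ compile (o + (csize c2 + 2)) d c1
  | Rep r c1 =>
      [:: IConst (15 + d) 0; IAdd (15 + d) r (15 + d)]
      ++ [:: IJz (15 + d) (o + (csize c1 + 5))]
      ++ compile (o + 3) d.+1 c1
      ++ [:: ISub (15 + d) (15 + d) 17] ++ [:: IJmp (o + 2)]
  end.

(** In [Rep], the 3 inside the sum is test, decrement and jump back; the 3 outside is the
    two-instruction set-up and the final test. *)
Fixpoint cost (c : cmd) (s : st) : nat :=
  match c with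
  | Skip => 0
  | Op o => size (op_code o)
  | Seq c1 c2 => cost c1 s + cost c2 (eval c1 s)
  | IfZ r c1 c2 => if reg s r == 0 then (cost c1 s).+1 else (cost c2 s).+2
  | Rep r c1 => \sum_(k < reg s r) (cost c1 (iter k (eval c1) s) + 3) + 3
  end.

Definition op_wf (o : op) : bool :=
  match o with
  | OConst r _ => r < 12
  | OAdd r j k | OSub r j k => [&& r < 12, j < 12 & k < 12]
  | ORead r a i | OWrite a i r => [&& r < 12, i < 12 & a < 32]
  end.

Fixpoint cmd_wf (d : nat) (c : cmd) : bool :=
  match c with
  | Skip => true
  | Op o => op_wf o
  | Seq c1 c2 => cmd_wf d c1 && cmd_wf d c2
  | IfZ r c1 c2 => [&& r < 12, cmd_wf d c1 & cmd_wf d c2]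
  | Rep r c1 => [&& r < 12, d < 2 & cmd_wf d.+1 c1]
  end.

(** * Correctness of the compiled code *)

Lemma size_compile o d c : size (compile o d c) = csize c.
Proof.
elim: c o d => //= [c1 IH1 c2 IH2|r c1 IH1 c2 IH2|r c1 IH1] o d.
- by rewrite size_cat IH1 IH2.
- by rewrite size_cat /= IH1 IH2; lia.
- by rewrite size_cat /= IH1; lia.
Qed.

Definition represents (B : nat) (s : st) (m : nat -> nat) :=
  [/\ forall r, r < 12 -> m r = reg s r,
      forall a i, a < 32 -> m (B + 32 * i + a) = arr s a i &
      [/\ m 12 = B, m 17 = 1 & 18 <= B]].

Lemma address_effect B s m a i : represents B s m -> i < 12 ->
  let m' := foldl effect m (address_code a i) in
  m' 13 = B + 32 * reg s i + a /\ forall x, x != 13 -> x != 14 -> m' x = m x.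
Proof.
move=> [mr _ [mB _ _]] i12; split => [|x x13 x14].
  rewrite /address_code /effect /= /upd /=.
  by rewrite mB mr //; lia.
by rewrite /address_code /effect /= /upd /= (negPf x13) (negPf x14).
Qed.

Lemma op_correct B s m o : op_wf o -> represents B s m ->
  let m' := foldl effect m (op_code o) in
  represents B (eval_op o s) m' /\ forall d, d < 2 -> m' (15 + d) = m (15 + d).
Proof.
case: s => R A; case: o => [r c|r j k|r j k|r a i|a i r] wf rep; rewrite /= in wf;
  have [mr ma [mB m1 B18]] := rep; rewrite /= in mr ma; cbv zeta; rewrite [eval_op _ _]/=.
- split=> [|d d2]; last by rewrite /effect /= /upd; case: eqP => //; lia.
  split; rewrite /effect /= /upd.
  + by move=> x x12 /=; case: eqP => // _; apply: mr.
  + by move=> a i a32 /=; case: eqP => [|_]; [lia|apply: ma].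
  + by do ![case: eqP => [|_]; first lia].
- have /and3P[r12 j12 k12] := wf.
  split=> [|d d2]; last by rewrite /effect /= /upd; case: eqP => //; lia.
  split; rewrite /effect /= /upd.
  + by move=> x x12 /=; case: eqP => // _; rewrite ?mr.
  + by move=> a i a32 /=; case: eqP => [|_]; [lia|apply: ma].
  + by do ![case: eqP => [|_]; first lia].
- have /and3P[r12 j12 k12] := wf.
  split=> [|d d2]; last by rewrite /effect /= /upd; case: eqP => //; lia.
  split; rewrite /effect /= /upd.
  + by move=> x x12 /=; case: eqP => // _; rewrite ?mr.
  + by move=> a i a32 /=; case: eqP => [|_]; [lia|apply: ma].
  + by do ![case: eqP => [|_]; first lia].
- have /and3P[r12 i12 a32] := wf.
  have [m13 mE] := address_effect a rep i12.
  move: m13 mE; rewrite /op_code foldl_rcons; set m' := foldl _ _ _ => /= m13 mE.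
  split=> [|d d2]; last by rewrite /effect /= /upd; case: eqP => [|_]; [lia|apply: mE; lia].
  split; rewrite /effect /= /upd m13.
  + move=> x x12 /=; case: eqP => [_|_]; last by rewrite mE ?mr //; lia.
    by rewrite mE ?ma //; lia.
  + by move=> a' i' a32' /=; case: eqP => [|_]; [lia|rewrite mE ?ma //; lia].
  + by do ![case: eqP => [|_]; first lia]; rewrite !mE.
have /and3P[r12 i12 a32] := wf.
have [m13 mE] := address_effect a rep i12.
move: m13 mE; rewrite /op_code foldl_rcons; set m' := foldl _ _ _ => /= m13 mE.
split=> [|d d2]; last by rewrite /effect /= /upd m13; case: eqP => [|_]; [lia|apply: mE; lia].
split; rewrite /effect /= /upd m13.
+ by move=> x x12 /=; case: eqP => [|_]; [lia|rewrite mE ?mr //; lia].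
+ move=> a' i' a32' /=; rewrite /upd_arr.
  rewrite (_ : (B + 32 * i' + a' == B + 32 * R i + a) = (a' == a) && (i' == R i)); last by lia.
  by case: ifP => _; [rewrite mE ?mr //; lia|rewrite mE ?ma //; lia].
+ by do ![case: eqP => [|_]; first lia]; rewrite !mE.
Qed.

Lemma represents_counter B s m d v : d < 2 -> represents B s m -> represents B s (upd m (15 +
  d) v).
Proof.
move=> d2 [mr ma [mB m1 B18]]; split; rewrite /upd.
- by move=> r r12; case: eqP => [|_]; [lia | apply: mr].
- by move=> a i a32; case: eqP => [|_]; [lia | apply: ma].
- by do ![case: eqP => [|_]; first lia].
Qed.

(** The last clause protects the counters of enclosing loops; it is what carries the induction
    through [Rep]. *)
Lemma compile_correct P B c o d s m :
  d <= 2 -> cmd_wf d c -> code_at P o (compile o d c) -> represents B s m ->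
  exists m', [/\ run P (cost c s) (State o m) = State (o + csize c) m',
    represents B (eval c s) m' & forall j, j < d -> m' (15 + j) = m (15 + j)].
Proof.
elim: c o d s m => [|h|c1 IH1 c2 IH2|r c1 IH1 c2 IH2|r c IH] o d s m d2 /=.
- by move=> _ _ rep; exists m; rewrite addn0.
- move=> wf cat rep; exists (foldl effect m (op_code h)).
  have jf : all jumpfree (op_code h) by case: (h).
  have [rep' keep] := op_correct wf rep.
  rewrite (run_jumpfree m jf cat); split => // j jd.
  by apply: keep; apply: leq_trans jd d2.
- move=> /andP[wf1 wf2] /code_at_cat[cat1]; rewrite size_compile => cat2 rep.
  have [m1 [run1E rep1 keep1]] := IH1 _ _ _ _ d2 wf1 cat1 rep.
  have [m2 [run2E rep2 keep2]] := IH2 _ _ _ _ d2 wf2 cat2 rep1.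
  exists m2; split => //; first by rewrite run_add run1E run2E addnA.
  by move=> j jd; rewrite keep2 ?keep1.
- move=> /and3P[r12 wf1 wf2] catz rep.
  have /code_at_cat[cat2] := code_at_cons catz; rewrite size_compile => catj.
  have cat1 := code_at_cons catj.
  have [mr _ _] := rep.
  have z1 := run1 m catz; rewrite /= mr // in z1.
  case: ifP z1 => _ z1.
    have [|m1 [run1E rep1 keep1]] := IH1 (o + (csize c2 + 2)) d s m d2 wf1 _ rep.
      by move: cat1; rewrite (_ : (o.+1 + csize c2).+1 = o + (csize c2 + 2)) //; lia.
    exists m1; split => //; rewrite -add1n run_add z1 run1E; congr State; lia.
  have [m1 [run1E rep1 keep1]] := IH2 _ _ _ _ d2 wf2 cat2 rep.
  exists m1; split => //.
  rewrite -addn1 -add1n -addnA run_add z1 run_add run1E (run1 _ catj) /=.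
  congr State; lia.
move=> /and3P[r12 dlt wf1] cat0 rep.
have cat1 := code_at_cons cat0; have catz := code_at_cons cat1.
have /code_at_cat[catb] := code_at_cons catz; rewrite size_compile => cats.
have catj := code_at_cons cats.
rewrite (_ : o.+3 = o + 3) in catb cats catj; last by lia.
set C := 15 + d; set N := reg s r.
have C0 : o + 3 + csize c = (o + csize c).+3 by lia.
(* The loop head is at [o + 2], after the instructions that load the counter; the extra step is the
   test that ends the loop. *)
suff loop k s' m' : represents B s' m' -> m' C = k -> 
    exists m'', [/\ run P (\sum_(i < k) (cost c (iter i (eval c) s') + 3) + 1) (State (o + 2)
      m') =
        State (o + (csize c + 5)) m'', represents B (iter k (eval c) s') m'' &
        forall j, j < d -> m'' (15 + j) = m' (15 + j)].
  pose m1 := upd (upd m C 0) C (m r + 0).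
  have rep1 : represents B s m1 by do 2 apply: represents_counter => //.
  have [mr _ _] := rep.
  have [|m2 [run2 rep2 keep2]] := loop N s m1 rep1.
    by rewrite /m1 /upd eqxx mr // addn0.
  exists m2; split => //; last first.
    move=> j jd; rewrite keep2 // /m1 /upd; case: eqP => //; rewrite /C; lia.
  set S := \sum_(i < N) _ in run2 *.
  rewrite (_ : S + 3 = 1 + (1 + (S + 1))); last by lia.
  rewrite run_add (run1 _ cat0) run_add /= (run1 _ cat1) /=.
  rewrite -run2 (_ : o.+2 = o + 2); last by lia.
  congr (run P _ (State _ _)); rewrite /m1 /upd eqxx.
  by rewrite (_ : r == C = false) //; rewrite /C; lia.
rewrite (_ : o.+2 = o + 2) in catz; last by lia.
elim: k s' m' => [|k IHk] s' m' rep' mC.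
  exists m'; split => //; rewrite big_ord0 add0n (run1 _ catz) /= mC /=; congr State; lia.
have [m1 [run1E rep1 keep1]] := IH _ _ _ _ dlt wf1 catb rep'.
have mC1 : m1 C = k.+1 by rewrite /C keep1.
pose m2 := upd m1 C (m1 C - m1 17).
have rep2 : represents B (eval c s') m2 by apply: represents_counter.
have [|m3 [run3 rep3 keep3]] := IHk (eval c s') m2 rep2.
  by rewrite /m2 /upd eqxx mC1; have [_ _ [_ -> _]] := rep1; rewrite subn1.
exists m3; split; last first.
- move=> j jd; rewrite keep3 // /m2 /upd; case: eqP => [|_]; first by rewrite /C; lia.
  by rewrite keep1 // ltnW.
- by rewrite iterSr.
rewrite big_ord_recl /= -addnA.
under eq_bigr => i _ do rewrite -iterS iterSr.
set S := \sum_(i < k) _ in run3 *.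
rewrite (_ : cost c s' + 3 + (S + 1) = 1 + (cost c s' + (1 + (1 + (S + 1))))); last by lia.
rewrite run_add (run1 _ catz) /= mC /=.
rewrite (_ : (o + 2).+1 = o + 3); last by lia.
rewrite run_add run1E run_add (run1 _ cats) /= run_add (run1 _ catj) /=.
exact: run3.
Qed.

(** * The program *)

Fixpoint written_regs (c : cmd) : seq nat :=
  match c with
  | Skip => [::]
  | Op (OConst r _) | Op (OAdd r _ _) | Op (OSub r _ _) | Op (ORead r _ _) => [:: r]
  | Op (OWrite _ _ _) => [::]
  | Seq c1 c2 | IfZ _ c1 c2 => written_regs c1 ++ written_regs c2
  | Rep _ c1 => written_regs c1
  end.

Fixpoint written_arrs (c : cmd) : seq nat :=
  match c with
  | Skip => [::]
  | Op (OWrite a _ _) => [:: a]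
  | Op _ => [::]
  | Seq c1 c2 | IfZ _ c1 c2 => written_arrs c1 ++ written_arrs c2
  | Rep _ c1 => written_arrs c1
  end.

Lemma frame_reg c s r : r \notin written_regs c -> reg (eval c s) r = reg s r.
Proof.
elim: c s => //= [h|c1 IH1 c2 IH2|t c1 IH1 c2 IH2|t c1 IH1] s.
- by case: s => R A; case: h => //= [x ?|x ? ?|x ? ?|x ? ?]; rewrite inE /upd => /negPf->.
- by rewrite mem_cat negb_or => /andP[r1 r2]; rewrite IH2 ?IH1.
- by rewrite mem_cat negb_or => /andP[r1 r2]; case: ifP => _; rewrite ?IH2 ?IH1.
by move=> r1; elim: (reg s t) => //= k; rewrite IH1.
Qed.

Lemma frame_arr c s a i : a \notin written_arrs c -> arr (eval c s) a i = arr s a i.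
Proof.
elim: c s => //= [h|c1 IH1 c2 IH2|t c1 IH1 c2 IH2|t c1 IH1] s.
- by case: s => R A; case: h => //= x ? ?; rewrite inE /upd_arr => /negPf->.
- by rewrite mem_cat negb_or => /andP[r1 r2]; rewrite IH2 ?IH1.
- by rewrite mem_cat negb_or => /andP[r1 r2]; case: ifP => _; rewrite ?IH2 ?IH1.
by move=> r1; elim: (reg s t) => //= k; rewrite IH1.
Qed.

Fixpoint loopfree (c : cmd) : bool :=
  match c with
  | Skip | Op _ => true
  | Seq c1 c2 | IfZ _ c1 c2 => loopfree c1 && loopfree c2
  | Rep _ _ => false
  end.

Fixpoint max_cost (c : cmd) : nat :=
  match c with
  | Skip | Rep _ _ => 0
  | Op o => size (op_code o)
  | Seq c1 c2 => max_cost c1 + max_cost c2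
  | IfZ _ c1 c2 => max_cost c1 + max_cost c2 + 2
  end.

Lemma cost_loopfree c s : loopfree c -> cost c s <= max_cost c.
Proof.
elim: c s => //= [c1 IH1 c2 IH2|t c1 IH1 c2 IH2] s /andP[l1 l2].
  by rewrite leq_add ?IH1 ?IH2.
have := IH1 s l1; have := IH2 s l2; case: ifP => _; lia.
Qed.

Definition cmds (cs : seq cmd) : cmd := foldr Seq Skip cs.

(* Registers: 1 holds the constant 1, 2 the number of vertices, 3 the position
   in the input (array 0), 4 the current vertex, 5 its degree, 6 the current
   neighbour, 7 an accumulator, 11 a row offset of the adjacency matrix; 0, 8, 9
   and 10 are scratch, and 0 finally holds the result. *)
Definition pass (ini body post : cmd) : cmd :=
  cmds [:: Op (OConst 3 1); Op (OConst 4 0);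
    Rep 2 (cmds [:: Op (ORead 5 0 3); Op (OAdd 3 3 1); ini;
      Rep 5 (cmds [:: Op (ORead 6 0 3); Op (OAdd 3 3 1); body]);
      post; Op (OAdd 4 4 1)])].

(** The fragments plugged into a pass leave its control registers and the input array alone. *)
Definition pass_ok (c : cmd) :=
  [&& loopfree c, all (fun r => r \in [:: 0; 7; 8; 9; 10; 11]) (written_regs c)
    & 0 \notin written_arrs c].

(** * Invariants and cost of a pass over the adjacency lists *)

Section Passes.
Variables (n : nat) (nb : nat -> seq nat).

(** Cell 0 of the input holds the number of vertices, and every list is preceded by its length. *)
Definition pos v := 1 + \sum_(i < v) (size (nb i)).+1.

Definition stored_input (s : st) := forall v, v < n ->
  arr s 0 (pos v) = size (nb v) /\
  forall j, j < size (nb v) -> arr s 0 (pos v + 1 + j) = nth 0 (nb v) j.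

Definition base (s : st) := [/\ reg s 1 = 1, reg s 2 = n & stored_input s].

Lemma stored_input_eq s s' : (forall i, arr s' 0 i = arr s 0 i) -> stored_input s ->
  stored_input s'.
Proof.
by move=> E si v vn; have [d js] := si v vn; split=> [|j jd]; rewrite E // js.
Qed.

Lemma pass_ok_reg c s r : pass_ok c -> 0 < r < 7 -> reg (eval c s) r = reg s r.
Proof.
move=> /and3P[_ /allP rs _] r7; apply: frame_reg; apply/negP => /rs; rewrite !inE; lia.
Qed.

Lemma pass_ok_base c s : pass_ok c -> base s -> base (eval c s).
Proof.
move=> ok [r1 r2 si]; split; rewrite ?pass_ok_reg //.
by apply: stored_input_eq si => i; apply: frame_arr; case/and3P: ok.
Qed.

Definition volume := \sum_(v < n) (size (nb v)).+1.

(** A Hoare rule: [Inv v] holds before vertex [v] is treated, [In v j] after [j] of its neighbours.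
    Register 11 is passed on from vertex to vertex, register 7 only within one vertex. Each input
    entry is read once, so the cost is linear in [volume]; the 40 covers the loop overhead. *)
Lemma pass_rule ini body post (Inv : nat -> (nat -> nat -> nat) -> nat -> Prop)
    (In : nat -> nat -> (nat -> nat -> nat) -> nat -> nat -> Prop) s :
  pass_ok ini -> pass_ok body -> pass_ok post ->
  (forall v s, v < n -> base s -> reg s 4 = v -> Inv v (arr s) (reg s 11) ->
     let s' := eval ini s in In v 0 (arr s') (reg s' 7) (reg s' 11)) ->
  (forall v j s, v < n -> j < size (nb v) -> base s -> reg s 4 = v ->
     reg s 6 = nth 0 (nb v) j -> In v j (arr s) (reg s 7) (reg s 11) ->
     let s' := eval body s in In v j.+1 (arr s') (reg s' 7) (reg s' 11)) ->
  (forall v s, v < n -> base s -> reg s 4 = v ->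
     In v (size (nb v)) (arr s) (reg s 7) (reg s 11) ->
     let s' := eval post s in Inv v.+1 (arr s') (reg s' 11)) ->
  base s -> Inv 0 (arr s) (reg s 11) ->
  let s' := eval (pass ini body post) s in
  [/\ base s', Inv n (arr s') (reg s' 11) &
    cost (pass ini body post) s <=
      (max_cost ini + max_cost body + max_cost post + 40) * (volume + 1)].
Proof.
move=> oki okb okp Hi Hb Hp bs I0.
set inner := cmds [:: Op (ORead 6 0 3); Op (OAdd 3 3 1); body].
set outer := cmds [:: Op (ORead 5 0 3); Op (OAdd 3 3 1); ini; Rep 5 inner; post; Op (OAdd 4 4 1)].
have innerP v j t : v < n -> j < size (nb v) -> base t -> reg t 4 = v ->
    reg t 3 = pos v + 1 + j -> In v j (arr t) (reg t 7) (reg t 11) ->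
    let t' := eval inner t in [/\ base t', reg t' 4 = v, reg t' 3 = pos v + 1 + j.+1,
      In v j.+1 (arr t') (reg t' 7) (reg t' 11) & cost inner t <= max_cost body + 10].
  case: t => R A vn jd [/= R1 R2 si] R4 R3 It.
  rewrite /inner /=.
  set t1 := St _ _.
  have b1 : base t1 by split; rewrite /t1 /= /upd /= ?R1.
  have [_ js] := si v vn; rewrite /= in js.
  split.
  - exact: pass_ok_base.
  - by rewrite pass_ok_reg // /t1 /= /upd.
  - by rewrite pass_ok_reg // /t1 /= /upd /= R3 R1; lia.
  - by apply: Hb; rewrite /t1 /= /upd //= R3 js.
  - have /and3P[lf _ _] := okb; have := cost_loopfree t1 lf; lia.
have innerI v k t : v < n -> k <= size (nb v) -> base t -> reg t 4 = v ->
    reg t 3 = pos v + 1 -> In v 0 (arr t) (reg t 7) (reg t 11) ->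
    let t' := iter k (eval inner) t in [/\ base t', reg t' 4 = v, reg t' 3 = pos v + 1 + k,
      In v k (arr t') (reg t' 7) (reg t' 11) &
      \sum_(i < k) (cost inner (iter i (eval inner) t) + 3) <= k * (max_cost body + 13)].
  move=> vn + bt R4 R3 It; elim: k => [|k IHk] kd /=.
    by rewrite addn0 big_ord0.
  have [b' R4' R3' I' c'] := IHk (ltnW kd).
  have [b'' R4'' R3'' I'' c''] := innerP v k _ vn kd b' R4' R3' I'.
  split => //; rewrite big_ord_recr /= mulSnr; apply: leq_add; first exact: c'.
  by rewrite (leq_trans (leq_add c'' (leqnn 3))) // -addnA.
set K := max_cost ini + max_cost body + max_cost post + 40.
have outerP v t : v < n -> base t -> reg t 4 = v -> reg t 3 = pos v -> Inv v (arr t) (reg t 11) ->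
    let t' := eval outer t in [/\ base t', reg t' 4 = v.+1, reg t' 3 = pos v.+1,
      Inv v.+1 (arr t') (reg t' 11) & cost outer t + 3 <= K * (size (nb v)).+1].
  case: t => R A vn [/= R1 R2 si] R4 R3 It; rewrite /outer /= -/inner.
  have [W0 _] := si v vn; rewrite /= in W0.
  set t1 := St _ _.
  have b1 : base t1 by split; rewrite /t1 /= /upd /= ?R1.
  have In0 := Hi v t1 vn b1 R4 It.
  have b2 := pass_ok_base oki b1.
  have r2 r : 0 < r < 7 -> reg (eval ini t1) r = reg t1 r by move=> r7; apply: pass_ok_reg.
  have R52 : reg (eval ini t1) 5 = size (nb v) by rewrite r2 // /t1 /= /upd /= R3 W0.
  have R42 : reg (eval ini t1) 4 = v by rewrite r2.
  have R32 : reg (eval ini t1) 3 = pos v + 1 by rewrite r2 // /t1 /= /upd /= R3 R1.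
  have [b3 R43 R33 I3 c3] := innerI v (size (nb v)) _ vn (leqnn _) b2 R42 R32 In0.
  rewrite R52; set t3 := iter _ _ _ in b3 R43 R33 I3 *.
  have b4 := pass_ok_base okp b3.
  have I4 := Hp v t3 vn b3 R43 I3.
  have R44 : reg (eval post t3) 4 = v by rewrite pass_ok_reg.
  have R34 : reg (eval post t3) 3 = pos v.+1.
    by rewrite pass_ok_reg // R33 /pos big_ord_recr /=; lia.
  have c2 : cost ini t1 <= max_cost ini by apply: cost_loopfree; case/and3P: oki.
  have c4 : cost post t3 <= max_cost post by apply: cost_loopfree; case/and3P: okp.
  have cK : size (nb v) * (max_cost body + 13) <= size (nb v) * K by rewrite leq_mul2l /K; lia.
  case: (eval post t3) b4 I4 R44 R34 => R' A' [R1' R2' si'] I4 R44 R34.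
  split => //; rewrite /= /upd /=.
  - by move: R1' R44 => /= -> ->; rewrite addn1.
  - rewrite mulnSr; move: c2 c4 c3 cK; rewrite /K.
    set S := \sum_(i < _) _; lia.
have outerI k t : k <= n -> base t -> reg t 4 = 0 -> reg t 3 = 1 -> Inv 0 (arr t) (reg t 11) ->
    let t' := iter k (eval outer) t in [/\ base t', reg t' 4 = k, reg t' 3 = pos k,
      Inv k (arr t') (reg t' 11) &
      \sum_(i < k) (cost outer (iter i (eval outer) t) + 3) <= K * \sum_(v < k) (size (nb v)).+1].
  move=> + bt R4 R3 It; elim: k => [|k IHk] kn /=.
    by rewrite /pos !big_ord0 muln0.
  have [b' R4' R3' I' c'] := IHk (ltnW kn).
  have [b'' R4'' R3'' I'' c''] := outerP k _ kn b' R4' R3' I'.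
  by split => //; rewrite !big_ord_recr /= mulnDr leq_add.
case: s bs I0 => R A [/= R1 R2 si] I0; rewrite -/inner -/outer.
set t := St _ _.
have bt : base t by split; rewrite /t /= /upd.
have [b' _ _ I' c'] := outerI n t (leqnn _) bt erefl erefl I0.
have tn : reg t 2 = n by case: bt.
rewrite /upd /= R2; split => //.
rewrite mulnDr muln1 addn0 /volume.
by move: c'; set S1 := \sum_(_ < n) (_ + 3); rewrite /K; set S2 := \sum_(_ < n) _; lia.
Qed.

Hypothesis nb_lt : forall v u, v < n -> u \in nb v -> u < n.

(* spec a v is the value that the program stores in cell v of array a. *)
Definition spec (a v : nat) : nat :=
  nth (fun=> 0)
   [:: fun=> 0; muln^~ n; dg nb; hub nb; far nb; fun v => rp nb v : nat; cov nb;
       tf nb; th nb; fun v => (tf nb v).+1 * (tf nb v).+1; r1 nb; r2 nb; cnt n nb;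
       fun v => (bad nb v ==> all (chk n nb v) (nb v)) : nat;
       fun i => \sum_(v < n) (i == 0) * ~~ (bad nb v ==> all (chk n nb v) (nb v))] a v.

Definition known k (A : nat -> nat -> nat) :=
  (forall a v, 0 < a < k -> v < n -> A a v = spec a v) /\
  (forall x y, x < n -> y < n -> A 31 (x * n + y) = mc nb x y).

(** Arrays not yet filled are still zero, which the passes that increment cells rely on. *)
Definition blank k (A : nat -> nat -> nat) := forall a i, k <= a < 31 -> A a i = 0.

Definition stage k s := [/\ base s, known k (arr s) & blank k (arr s)].

(** The pattern in which the value at [v] is a fold over the neighbours of [v], accumulated in
    register 7. In the bound, 49 is the overhead of a pass plus the nine instructions of the
    write. *)
Lemma pull_pass k ini body (g : nat -> nat -> nat -> nat) (i0 : nat -> nat) s :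
  0 < k < 31 -> pass_ok ini -> pass_ok body ->
  nilp (written_arrs ini) -> nilp (written_arrs body) ->
  (forall v s, v < n -> base s -> known k (arr s) -> reg s 4 = v -> reg (eval ini s) 7 = i0 v) ->
  (forall v u s, v < n -> u \in nb v -> base s -> known k (arr s) -> reg s 4 = v ->
     reg s 6 = u -> reg (eval body s) 7 = g v u (reg s 7)) ->
  (forall v, v < n -> foldl (fun a u => g v u a) (i0 v) (nb v) = spec k v) ->
  stage k s -> let post := Op (OWrite k 4 7) in
  stage k.+1 (eval (pass ini body post) s) /\
  cost (pass ini body post) s <= (max_cost ini + max_cost body + 49) * (volume + 1).
Proof.
move=> k31 oki okb /nilP wi /nilP wb Hi Hb Hs [bs kn bl] post.
have fa c t a i : written_arrs c = [::] -> arr (eval c t) a i = arr t a i.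
  by move=> w; apply: frame_arr; rewrite w.
have kn_eq A A' : known k A -> (forall a i, a != k -> A' a i = A a i) -> known k A'.
  move=> [k1 k2] E; split=> [a v ak vn|x y xn yn]; first by rewrite E ?k1 //; lia.
  by rewrite E ?k2 //; lia.
pose Inv v (A : nat -> nat -> nat) (_ : nat) :=
  (forall a i, a != k -> A a i = arr s a i) /\ (forall u, u < v -> A k u = spec k u).
pose In v j (A : nat -> nat -> nat) acc (r : nat) := Inv v A r /\
  acc = foldl (fun a u => g v u a) (i0 v) (take j (nb v)).
have [||||||||b' [fr sp] co] := @pass_rule ini body post Inv In s.
- by [].
- by [].
- by rewrite /pass_ok /post /= inE; lia.
- move=> v t vn bt R4 [fr sp] /=; split; last first.
    by rewrite take0 /=; apply: Hi => //; apply: kn_eq kn fr.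
  by split=> [a i ak|u uv]; rewrite fa //; [apply: fr|apply: sp].
- move=> v j t vn jd bt R4 R6 [[fr sp] acc] /=; split.
    by split=> [a i ak|u uv]; rewrite fa //; [apply: fr|apply: sp].
  rewrite (take_nth 0) // foldl_rcons -acc; apply: Hb => //; first exact: mem_nth.
  exact: kn_eq kn fr.
- move=> v [R A] vn bt R4 [[/= fr sp] acc]; rewrite /= in R4; split => [a i ak|u uv].
    by rewrite /upd_arr (negPf ak) /= fr.
  rewrite /upd_arr eqxx /= R4; case: eqP => [->|ne]; last by apply: sp; lia.
  by rewrite acc take_size Hs.
- exact: bs.
- by split.
split; last by move: co; rewrite /post /= -!addnA.
split => //; last by move=> a i ak; rewrite fr ?bl //; lia.
have [kn1 kn2] := kn; split=> [a v ak vn|x y xn yn]; last by rewrite fr ?kn2 //; lia.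
have [->|ne] := eqVneq a k; first exact: sp.
by rewrite fr // kn1 //; lia.
Qed.

Lemma push_pass k post (idx amt : nat -> nat) s :
  0 < k < 31 -> pass_ok post -> written_arrs post = [:: k] ->
  (forall v s, v < n -> base s -> known k (arr s) -> reg s 4 = v ->
     forall i, arr (eval post s) k i = arr s k i + (i == idx v) * amt v) ->
  (forall i, i < n -> \sum_(v < n) (i == idx v) * amt v = spec k i) ->
  stage k s ->
  stage k.+1 (eval (pass Skip Skip post) s) /\
  cost (pass Skip Skip post) s <= (max_cost post + 40) * (volume + 1).
Proof.
move=> k31 okp wp Hp Hs [bs kn bl].
have kn_eq A A' : known k A -> (forall a i, a != k -> A' a i = A a i) -> known k A'.
  move=> [k1 k2] E; split=> [a v ak vn|x y xn yn]; first by rewrite E ?k1 //; lia.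
  by rewrite E ?k2 //; lia.
pose Inv v (A : nat -> nat -> nat) (_ : nat) :=
  (forall a i, a != k -> A a i = arr s a i) /\
  (forall i, A k i = \sum_(u < v) (i == idx u) * amt u).
pose In v (j : nat) A (acc : nat) := Inv v A.
have [||||||||b' [fr sp] co] := @pass_rule Skip Skip post Inv In s.
- by [].
- by [].
- by [].
- by [].
- by [].
- move=> v t vn bt R4 [fr sp] /=; split => [a i ak|i].
    by rewrite frame_arr ?fr // wp inE.
  by rewrite (Hp _ _ vn bt (kn_eq _ _ kn fr) R4) sp big_ord_recr.
- exact: bs.
- by split => // i; rewrite bl ?big_ord0 //; lia.
split; last by move: co; rewrite /= !add0n.
split => //; last by move=> a i ak; rewrite fr ?bl //; lia.
have [kn1 kn2] := kn; split=> [a v ak vn|x y xn yn]; last by rewrite fr ?kn2 //; lia.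
have [->|ne] := eqVneq a k; first by rewrite sp Hs.
by rewrite fr // kn1 //; lia.
Qed.

(* Only the entries equal to 1 of the closed adjacency matrix (array 31) are
   written; the row offsets v * n go to array 1. *)
Definition matrix_pass := pass
  (cmds [:: Op (OWrite 1 4 11); Op (OAdd 8 11 4); Op (OWrite 31 8 1)])
  (cmds [:: Op (OAdd 8 11 6); Op (OWrite 31 8 1)])
  (Op (OAdd 11 11 2)).

Lemma matrix_passP s : base s -> (forall a i, 0 < a < 32 -> arr s a i = 0) -> reg s 11 = 0 ->
  stage 2 (eval matrix_pass s) /\ cost matrix_pass s <= 100 * (volume + 1).
Proof.
move=> bs z R0.
have idx_inj x y x' y' : y < n -> y' < n -> (x * n + y == x' * n + y') = (x == x') && (y == y').
  move=> yn yn'; apply/eqP/andP => [E|[/eqP-> /eqP->]//].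
  have n0 : 0 < n by lia.
  have := congr1 (divn^~ n) E; have := congr1 (modn^~ n) E.
  by rewrite !modnMDl !divnMDl // !modn_small // !divn_small // !addn0 => -> ->.
pose Inv' v (A : nat -> nat -> nat) r := r = v * n /\ [/\ forall i, A 0 i = arr s 0 i,
  forall a i, 1 < a < 31 -> A a i = 0 & forall u, u < v -> A 1 u = u * n].
pose Inv v A r := Inv' v A r /\
  forall x y, x < n -> y < n -> A 31 (x * n + y) = if x < v then mc nb x y : nat else 0.
(* While row [v] is being filled it holds its diagonal entry and the neighbours read so far; later
   rows are still zero. *)
pose In v j A (acc : nat) r := (r = v * n /\ Inv' v.+1 A (v.+1 * n)) /\
  forall x y, x < n -> y < n -> A 31 (x * n + y) =
    if x < v then mc nb x y : nat else (x == v) && ((x == y) || (y \in take j (nb v))).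
have [||||||||b' [[_ [fr0 fz f1]] fm] co] := @pass_rule
  (cmds [:: Op (OWrite 1 4 11); Op (OAdd 8 11 4); Op (OWrite 31 8 1)])
  (cmds [:: Op (OAdd 8 11 6); Op (OWrite 31 8 1)]) (Op (OAdd 11 11 2)) Inv In s.
- by [].
- by [].
- by [].
- move=> v [R A] vn [/= R1 R2 si] R4 [[Rr [f0 fz f1]] fm]; rewrite /= in R4 Rr f0 fz f1 fm *.
  rewrite /upd /= /upd_arr /= R4 Rr R1; split; last first.
    move=> x y xn yn /=; rewrite idx_inj // take0 in_nil orbF.
    have [->|xv] /= := eqVneq x v; first by rewrite fm // ltnn (eq_sym v); case: eqP.
    by rewrite fm.
  split => //; split => //; split => //= [a i a31|u uv].
    by rewrite ifF ?ifF ?fz //; lia.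
  by case: eqP => [->//|ne]; rewrite f1 //; lia.
- move=> v j [R A] vn jd [/= R1 R2 si] R4 R6 [[Rr [_ [f0 fz f1]]] fm].
  rewrite /= in R4 R6 Rr f0 fz f1 fm *.
  rewrite /upd /= /upd_arr /= R6 Rr R1; split; last first.
    have un : nth 0 (nb v) j < n by apply: nb_lt vn (mem_nth _ jd).
    move=> x y xn yn /=; rewrite idx_inj // (take_nth 0) // mem_rcons in_cons fm //.
    have [->|xv] //= := eqVneq x v; rewrite ltnn.
    by case: (y == nth 0 (nb v) j) => //; rewrite orbT.
  split => //; split => //; split => //= a i a31.
  by rewrite ifF ?fz //; lia.
- move=> v [R A] vn [/= R1 R2 si] R4 [[Rr [_ [f0 fz f1]]] fm]; rewrite /= in Rr f0 fz f1 fm *.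
  rewrite /upd /= Rr R2; split; first by split; [lia | split].
  move=> x y xn yn; rewrite fm // take_size [x < v.+1]ltnS [x <= v]leq_eqVlt.
  by have [->|xv] := eqVneq x v; rewrite ?ltnn //=; case: ltnP.
- exact: bs.
- split; last by move=> x y xn yn; rewrite z.
  by rewrite R0; split => //; split => // a i a31; rewrite z //; lia.
split; last by apply: leq_trans co _; rewrite leq_mul2r; apply/orP; right.
split => //; split=> [a v a2 vn|x y xn yn]; last by rewrite fm // xn.
by rewrite (_ : a = 1) ?f1 //; lia.
Qed.

Lemma foldl_sum (f : nat -> nat) i s : foldl (fun a u => a + f u) i s = i + \sum_(u <- s) f u.
Proof.
by elim: s i => [|u s IH] i /=; rewrite ?big_nil ?addn0 // big_cons IH addnA.
Qed.

Lemma foldl_max (f : nat -> nat) i s :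
  foldl (fun a u => a + (f u - a)) i s = maxn i (\max_(u <- s) f u).
Proof.
elim: s i => [|u s IH] i /=; first by rewrite big_nil maxn0.
by rewrite big_cons IH maxnA -maxnE.
Qed.

Lemma foldl_reset (p : pred nat) i s :
  foldl (fun a u => if p u then 0 else a) i s = if has p s then 0 else i.
Proof.
elim: s i => //= u s IH i; rewrite IH; case: (p u) => //=.
by case: ifP.
Qed.

Lemma max_lt (f : nat -> nat) v : v < n -> (forall u, u < n -> f u < n) ->
  \max_(u <- nb v) f u < n.
Proof.
move=> vn h; rewrite big_seq; elim/big_ind: _ => [|x y xn yn|u uv]; first by lia.
  by rewrite gtn_max xn.
by apply: h; apply: nb_lt uv.
Qed.

Lemma hub_lt v : v < n -> hub nb v < n.
Proof. by move=> vn; apply: (max_lt (f := id)). Qed.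

Lemma r1_lt v : v < n -> r1 nb v < n.
Proof. by move=> vn; rewrite /r1 gtn_max vn (max_lt (f := id)). Qed.

Lemma r2_lt v : v < n -> r2 nb v < n.
Proof. by move=> vn; rewrite /r2 gtn_max r1_lt //= max_lt //; apply: r1_lt. Qed.

(** For simplicial [v] the predecessor is 0, still a valid row of the matrix, so [th_pass] needs no
    case distinction. *)
Lemma far_lt v : v < n -> (far nb v).-1 < n.
Proof.
move=> vn; have := farP nb v; case: eqP => [->|_ [u uv [-> _]]] /=; first by lia.
exact: nb_lt uv.
Qed.

(** * The individual passes *)

Local Notation load r a i := (Op (ORead r a i)).

Definition deg_pass := pass (Op (OConst 7 0)) (Op (OAdd 7 7 1)) (Op (OWrite 2 4 7)).

Definition hub_pass := pass (Op (OConst 7 0))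
  (cmds [:: Op (OSub 8 6 7); Op (OAdd 7 7 8)]) (Op (OWrite 3 4 7)).

Definition far_pass := pass (Op (OConst 7 0))
  (cmds [:: load 8 3 4; load 8 1 8; Op (OAdd 8 8 6); load 8 31 8;
            IfZ 8 (Op (OAdd 7 6 1)) Skip]) (Op (OWrite 4 4 7)).

Definition rp_pass := pass
  (cmds [:: load 8 4 4; IfZ 8 (Op (OConst 7 1)) (Op (OConst 7 0))])
  (cmds [:: load 8 4 6; IfZ 8 (cmds [:: Op (OSub 8 6 4); IfZ 8 Skip (Op (OConst 7 0))]) Skip])
  (Op (OWrite 5 4 7)).

Definition cov_pass := pass
  (cmds [:: load 8 5 4; IfZ 8 (Op (OConst 7 0)) (load 7 2 4)])
  (cmds [:: load 8 5 6; IfZ 8 Skip (cmds [:: load 8 2 6; Op (OAdd 7 7 8)])])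
  (Op (OWrite 6 4 7)).

Definition tf_pass := pass (Op (OConst 7 0))
  (cmds [:: load 8 3 4; load 8 1 8; Op (OAdd 8 8 6); load 8 31 8; Op (OAdd 7 7 8)])
  (Op (OWrite 7 4 7)).

Definition th_pass := pass (Op (OConst 7 0))
  (cmds [:: load 8 4 4; Op (OSub 8 8 1); load 8 1 8; Op (OAdd 8 8 6); load 8 31 8;
            Op (OAdd 7 7 8)])
  (Op (OWrite 8 4 7)).

(** A square without multiplication: [tf v] + 1 is taken once at the start and added once more for
    each of the [tf v] neighbours that [tf] counts. *)
Definition sq_pass := pass (cmds [:: load 7 7 4; Op (OAdd 7 7 1)])
  (cmds [:: load 8 3 4; load 8 1 8; Op (OAdd 8 8 6); load 8 31 8;
            IfZ 8 Skip (cmds [:: load 8 7 4; Op (OAdd 7 7 8); Op (OAdd 7 7 1)])])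
  (Op (OWrite 9 4 7)).

Definition r1_pass := pass (cmds [:: Op (OConst 7 0); Op (OAdd 7 7 4)])
  (cmds [:: Op (OSub 8 6 7); Op (OAdd 7 7 8)]) (Op (OWrite 10 4 7)).

Definition r2_pass := pass (load 7 10 4)
  (cmds [:: load 8 10 6; Op (OSub 8 8 7); Op (OAdd 7 7 8)]) (Op (OWrite 11 4 7)).

Definition cnt_pass := pass Skip Skip
  (cmds [:: load 8 11 4; load 9 12 8; Op (OAdd 9 9 1); Op (OWrite 12 8 9)]).

(* Adds |R8 - R9| to the discrepancy counter in register 10. *)
Definition compare := cmds
  [:: Op (OSub 0 8 9); Op (OAdd 10 10 0); Op (OSub 0 9 8); Op (OAdd 10 10 0)].

Definition chk_bad := cmds [:: load 8 6 4; load 9 2 4; Op (OSub 8 9 8)].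

(** Register 10 starts as 1 if [u] is not bad and as 0 otherwise. All later comparisons add to it,
    so it ends at zero exactly if every condition of [chk] holds. *)
Definition chk_common := cmds
  [:: load 8 6 6; load 9 2 6; Op (OSub 8 9 8); Op (OSub 10 1 8);
      load 8 7 6; load 9 7 4; compare].

(** Register 9 holds [tf v] at this point; register 8 becomes its distance from 1. *)
Definition chk_branch := cmds [:: Op (OSub 8 9 1); Op (OSub 9 1 9); Op (OAdd 8 8 9)].

Definition chk_hub := cmds [:: load 9 3 4; load 8 3 9; load 9 3 6; compare].
Definition chk_dg := cmds [:: load 9 3 4; load 8 2 9; load 9 2 6; compare].
Definition chk_r2 := cmds [:: load 8 11 6; load 9 11 4; compare].
Definition chk_cnt := cmds [:: load 9 11 4; load 8 12 9; load 9 9 4; compare].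
Definition chk_th := cmds [:: load 8 8 4; load 9 7 4; compare].
Definition chk_2tf := cmds [:: load 9 7 4; Op (OAdd 8 9 9); load 9 2 4; compare].

Definition chk_body := cmds
  [:: chk_bad;
      IfZ 8 Skip (cmds
        [:: chk_common; chk_branch;
            IfZ 8 (cmds [:: chk_hub; chk_dg]) (cmds [:: chk_r2; chk_th; chk_2tf; chk_cnt]);
            IfZ 10 Skip (Op (OConst 7 0))])].

Definition chk_pass := pass (cmds [:: Op (OConst 7 0); Op (OAdd 7 7 1)]) chk_body
  (Op (OWrite 13 4 7)).

(** Cell 0 of array 14 counts the vertices whose check failed. *)
Definition fin_pass := pass Skip Skip
  (cmds [:: load 8 13 4; Op (OSub 9 1 8); Op (OConst 8 0); load 10 14 8;
            Op (OAdd 10 10 9); Op (OWrite 14 8 10)]).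

Definition advances k c := forall s, stage k s ->
  stage k.+1 (eval c s) /\ cost c s <= 1000 * (volume + 1).

Lemma leq_volume a b : a <= b -> a * (volume + 1) <= b * (volume + 1).
Proof. by move=> ab; rewrite leq_mul2r ab orbT. Qed.

Lemma pull_advances k ini body (g : nat -> nat -> nat -> nat) (i0 : nat -> nat) :
  [&& 0 < k < 31, pass_ok ini, pass_ok body, nilp (written_arrs ini),
      nilp (written_arrs body) & max_cost ini + max_cost body + 49 <= 1000] ->
  (forall v s, v < n -> base s -> known k (arr s) -> reg s 4 = v -> reg (eval ini s) 7 = i0 v) ->
  (forall v u s, v < n -> u \in nb v -> base s -> known k (arr s) -> reg s 4 = v ->
     reg s 6 = u -> reg (eval body s) 7 = g v u (reg s 7)) ->
  (forall v, v < n -> foldl (fun a u => g v u a) (i0 v) (nb v) = spec k v) ->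
  advances k (pass ini body (Op (OWrite k 4 7))).
Proof.
case/and5P=> k31 oki okb wi /andP[wb cK] Hi Hb Hs s st.
have [st' co] := pull_pass k31 oki okb wi wb Hi Hb Hs st.
by split => //; apply: leq_trans co _; apply: leq_volume.
Qed.

Lemma push_advances k post (idx amt : nat -> nat) :
  [&& 0 < k < 31, pass_ok post, written_arrs post == [:: k] & max_cost post + 40 <= 1000] ->
  (forall v s, v < n -> base s -> known k (arr s) -> reg s 4 = v ->
     forall i, arr (eval post s) k i = arr s k i + (i == idx v) * amt v) ->
  (forall i, i < n -> \sum_(v < n) (i == idx v) * amt v = spec k i) ->
  advances k (pass Skip Skip post).
Proof.
case/and4P=> k31 okp /eqP wp cK Hp Hs s st.
have [st' co] := push_pass k31 okp wp Hp Hs st.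
by split => //; apply: leq_trans co _; apply: leq_volume.
Qed.

Lemma matrix_row k (A : nat -> nat -> nat) v u x : 1 < k -> known k A -> v < n -> u \in nb v ->
  x < n -> A 31 (A 1 x + u) = mc nb x u.
Proof.
move=> k1 [kn km] vn uv xn; rewrite (kn 1) ?k1 // [spec _ _]/= km //; exact: nb_lt uv.
Qed.

Lemma deg_advances : advances 2 deg_pass.
Proof.
apply: (@pull_advances 2 _ _ (fun _ _ a => a + 1) (fun=> 0)) => //.
- by move=> v [R A].
- by move=> v u [R A] vn uv [/= R1 _ _] _ _ _; rewrite /upd /= R1.
- by move=> v vn; rewrite (foldl_sum (fun=> 1)) sum1_size.
Qed.

Lemma hub_advances : advances 3 hub_pass.
Proof.
apply: (@pull_advances 3 _ _ (fun _ u a => a + (u - a)) (fun=> 0)) => //.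
- by move=> v [R A].
- by move=> v u [R A] vn uv _ _ _ /= <-.
- by move=> v vn; rewrite (foldl_max id) max0n.
Qed.

Lemma far_advances : advances 4 far_pass.
Proof.
apply: (@pull_advances 4 _ _ (fun v u a =>
  if mc nb (hub nb v) u then a else u.+1) (fun=> 0)) => //.
- by move=> v [R A].
- move=> v u [R A] vn uv [/= R1 _ _] /= kn R4 R6; rewrite /upd /= R4 R6 R1 (kn.1 3) // /spec /=.
  rewrite (matrix_row _ kn vn uv) ?hub_lt //.
  by case: (mc _ _ _); rewrite // /spec /= addn1.
Qed.

Lemma rp_advances : advances 5 rp_pass.
Proof.
apply: (@pull_advances 5 _ _ (fun v u a =>
  if (far nb u == 0) && (v < u) then 0 else a) (fun v => far nb v == 0)) => //.
- move=> v [R A] vn _ /= kn R4; rewrite /upd /= R4 (kn.1 4) //=.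
  by case: eqP.
- move=> v u [R A] vn uv _ /= kn R4 R6; have un := nb_lt vn uv.
  rewrite /upd /= R6 (kn.1 4) //= R4; case: eqP => //= _.
  by rewrite subn_eq0; case: leqP.
- move=> v vn; rewrite (foldl_reset (fun u => (far nb u == 0) && (v < u))) /spec /= /rp.
  rewrite [all _ _](all_predC (fun u => (far nb u == 0) && (v < u))).
  by case: (far nb v == 0); case: has.
Qed.

Lemma cov_advances : advances 6 cov_pass.
Proof.
apply: (@pull_advances 6 _ _ (fun v u a => a + if rp nb u then dg nb u else 0) (fun v =>
  if rp nb v then dg nb v else 0)) => //.
- move=> v [R A] vn _ /= kn R4; rewrite /upd /= R4 (kn.1 5) // /spec /=.
  by case: (rp nb v); rewrite //= (kn.1 2).
- move=> v u [R A] vn uv _ /= kn R4 R6; have un := nb_lt vn uv.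
  rewrite /upd /= R6 (kn.1 5) // /spec /=; case: (rp nb u); rewrite /= ?addn0 //.
  by rewrite (kn.1 2).
- by move=> v vn; rewrite (foldl_sum (fun u => if rp nb u then dg nb u else 0)).
Qed.

Lemma tf_advances : advances 7 tf_pass.
Proof.
apply: (@pull_advances 7 _ _ (fun v u a => a + mc nb (hub nb v) u) (fun=> 0)) => //.
- by move=> v [R A].
- move=> v u [R A] vn uv _ /= kn R4 R6; rewrite /upd /= R4 R6 (kn.1 3) // /spec /=.
  by rewrite (matrix_row _ kn vn uv) ?hub_lt.
- by move=> v vn; rewrite (foldl_sum (fun u => mc nb (hub nb v) u : nat)).
Qed.

Lemma th_advances : advances 8 th_pass.
Proof.
apply: (@pull_advances 8 _ _ (fun v u a => a + mc nb (far nb v).-1 u) (fun=> 0)) => //.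
- by move=> v [R A].
- move=> v u [R A] vn uv [/= R1 _ _] /= kn R4 R6;
    rewrite /upd /= R4 R6 R1 (kn.1 4) // /spec /= subn1.
  by rewrite (matrix_row _ kn vn uv) ?far_lt.
- by move=> v vn; rewrite (foldl_sum (fun u => mc nb (far nb v).-1 u : nat)).
Qed.

Lemma sq_advances : advances 9 sq_pass.
Proof.
apply: (@pull_advances 9 _ _ (fun v u a => a + mc nb (hub nb v) u * (tf nb v).+1) (fun v =>
  (tf nb v).+1)) => //.
- by move=> v [R A] vn [/= R1 _ _] /= kn R4; rewrite /upd /= R4 R1 (kn.1 7) // /spec /= addn1.
- move=> v u [R A] vn uv [/= R1 _ _] /= kn R4 R6; rewrite /upd /= R4 R6 (kn.1 3) // /spec /=.
  rewrite (matrix_row _ kn vn uv) ?hub_lt //.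
  case: (mc _ _ _); rewrite /= ?mul0n ?addn0 //.
  by rewrite (kn.1 7) // /spec /= mul1n R1 addn1 addnS.
- move=> v vn; rewrite (foldl_sum (fun u => mc nb (hub nb v) u * (tf nb v).+1)).
  by rewrite -big_distrl.
Qed.

Lemma r1_advances : advances 10 r1_pass.
Proof.
apply: (@pull_advances 10 _ _ (fun _ u a => a + (u - a)) id) => //.
- by move=> v [R A] vn _ _ /= R4; rewrite /upd /= R4.
- by move=> v u [R A] vn uv _ _ _ /= <-.
- by move=> v vn; rewrite (foldl_max id).
Qed.

Lemma r2_advances : advances 11 r2_pass.
Proof.
apply: (@pull_advances 11 _ _ (fun _ u a => a + (r1 nb u - a)) (r1 nb)) => //.
- by move=> v [R A] vn _ /= kn R4; rewrite /upd /= R4 (kn.1 10).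
- move=> v u [R A] vn uv _ /= kn R4 R6; rewrite /upd /= R6 (kn.1 10) //.
  exact: nb_lt uv.
- by move=> v vn; rewrite (foldl_max (r1 nb)).
Qed.

Lemma cnt_advances : advances 12 cnt_pass.
Proof.
apply: (@push_advances 12 (cmds [:: load 8 11 4; load 9 12 8; Op (OAdd 9 9 1);
  Op (OWrite 12 8 9)])
  (r2 nb) (fun=> 1)) => //.
- move=> v [R A] vn [/= R1 _ _] /= kn R4 i;
    rewrite /upd /= R4 R1 /upd_arr /= (kn.1 11) // /spec /=.
  by case: eqP => [->|_]; rewrite ?addn0.
- move=> i iN; rewrite /spec /= /cnt big_mkord; apply: eq_bigr => v _.
  by rewrite muln1 eq_sym.
Qed.

Lemma fin_advances : advances 14 fin_pass.
Proof.
apply: (@push_advances 14 (cmds [:: load 8 13 4; Op (OSub 9 1 8); Op (OConst 8 0); load 10 14 8;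
            Op (OAdd 10 10 9); Op (OWrite 14 8 10)])
  (fun=> 0) (fun v => ~~ (bad nb v ==> all (chk n nb v) (nb v)))) => //.
- move=> v [R A] vn [/= R1 _ _] /= kn R4 i;
    rewrite /upd /= R4 R1 /upd_arr /= (kn.1 13) // /spec /=.
  by case: eqP => [->|_]; rewrite ?mul1n ?mul0n ?addn0 //; case: (_ ==> _).
Qed.

(** * The check of one neighbour *)

Section Check.
Variables (v u acc : nat) (A0 : nat -> nat -> nat).
Hypotheses (vn : v < n) (uv : u \in nb v) (kn : known 13 A0).

Definition context s :=
  [/\ forall a i, arr s a i = A0 a i, reg s 1 = 1, reg s 4 = v, reg s 6 = u & reg s 7 = acc].

Lemma context_frame c s : context s -> written_arrs c = [::] ->
  all (fun r => r \notin [:: 1; 4; 6; 7]) (written_regs c) -> context (eval c s).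
Proof.
move=> [As r1 r4 r6 r7] wa /allP wr.
have fr r : r \in [:: 1; 4; 6; 7] -> reg (eval c s) r = reg s r.
  by move=> rin; apply: frame_reg; apply/negP => /wr; rewrite rin.
by split; rewrite ?fr // => a i; rewrite frame_arr ?wa.
Qed.

Lemma context_arr s a x : context s -> 0 < a < 13 -> x < n -> arr s a x = spec a x.
Proof. by move=> [As _ _ _ _] a13 xn; rewrite As kn.1. Qed.

Local Notation diff a b := ((a - b) + (b - a)).

Lemma chk_badP s : context s -> reg (eval chk_bad s) 8 = dg nb v - cov nb v.
Proof.
move=> cx; have E a x := @context_arr s a x cx; case: s cx E => R A [/= _ r1 r4 r6 r7] E.
by rewrite /upd /= !r4 (E 6) // (E 2).
Qed.

Lemma chk_commonP s : context s ->
  reg (eval chk_common s) 10 = 1 - (dg nb u - cov nb u) + diff (tf nb u) (tf nb v) /\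
  reg (eval chk_common s) 9 = tf nb v.
Proof.
move=> cx; have un := nb_lt vn uv; have E a x := @context_arr s a x cx.
case: s cx E => R A [/= _ r1 r4 r6 r7] E.
by rewrite /upd /= !r4 !r6 r1 (E 6) // (E 2) // !(E 7) // addnA.
Qed.

Lemma chk_branchP s : context s -> reg (eval chk_branch s) 8 = diff (reg s 9) 1.
Proof. by case: s => R A [/= _ r1 _ _ _]; rewrite /upd /= r1. Qed.

Lemma chk_hubP s : context s ->
  reg (eval chk_hub s) 10 = reg s 10 + diff (hub nb (hub nb v)) (hub nb u).
Proof.
move=> cx; have un := nb_lt vn uv; have E a x := @context_arr s a x cx.
case: s cx E => R A [/= _ r1 r4 r6 r7] E; have hn := hub_lt vn.
by rewrite /upd /= !r4 !r6 (E 3 v) // (E 3 (hub nb v)) // (E 3 u) // addnA.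
Qed.

Lemma chk_dgP s : context s ->
  reg (eval chk_dg s) 10 = reg s 10 + diff (dg nb (hub nb v)) (dg nb u).
Proof.
move=> cx; have un := nb_lt vn uv; have E a x := @context_arr s a x cx.
case: s cx E => R A [/= _ r1 r4 r6 r7] E; have hn := hub_lt vn.
by rewrite /upd /= !r4 !r6 (E 3 v) // (E 2 (hub nb v)) // (E 2 u) // addnA.
Qed.

Lemma chk_r2P s : context s -> reg (eval chk_r2 s) 10 = reg s 10 + diff (r2 nb u) (r2 nb v).
Proof.
move=> cx; have un := nb_lt vn uv; have E a x := @context_arr s a x cx.
case: s cx E => R A [/= _ r1 r4 r6 r7] E.
by rewrite /upd /= !r4 !r6 (E 11 v) // (E 11 u) // addnA.
Qed.

Lemma chk_cntP s : context s -> reg (eval chk_cnt s) 10 =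
  reg s 10 + diff (cnt n nb (r2 nb v)) ((tf nb v).+1 * (tf nb v).+1).
Proof.
move=> cx; have E a x := @context_arr s a x cx; have rn := r2_lt vn.
case: s cx E => R A [/= _ r1 r4 r6 r7] E.
by rewrite /upd /= !r4 (E 11 v) // (E 12 (r2 nb v)) // (E 9 v) // addnA.
Qed.

Lemma chk_thP s : context s -> reg (eval chk_th s) 10 = reg s 10 + diff (th nb v) (tf nb v).
Proof.
move=> cx; have E a x := @context_arr s a x cx.
case: s cx E => R A [/= _ r1 r4 r6 r7] E.
by rewrite /upd /= !r4 (E 8 v) // (E 7 v) // addnA.
Qed.

Lemma chk_2tfP s : context s ->
  reg (eval chk_2tf s) 10 = reg s 10 + diff (tf nb v + tf nb v) (dg nb v).
Proof.
move=> cx; have E a x := @context_arr s a x cx.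
case: s cx E => R A [/= _ r1 r4 r6 r7] E.
by rewrite /upd /= !r4 (E 7 v) // (E 2 v) // addnA.
Qed.

Lemma chk_bodyP s : context s ->
  reg (eval chk_body s) 7 = if bad nb v && ~~ chk n nb v u then 0 else acc.
Proof.
move=> cx; pose s1 := eval chk_bad s; pose s2 := eval chk_common s1;
  pose s3 := eval chk_branch s2.
pose s4 := if reg s3 8 == 0 then eval chk_dg (eval chk_hub s3)
  else eval chk_cnt (eval chk_2tf (eval chk_th (eval chk_r2 s3))).
have -> : eval chk_body s = if reg s1 8 == 0 then s1 else
    if reg s4 10 == 0 then s4 else eval (Op (OConst 7 0)) s4.
  by [].
rewrite /s1 (chk_badP cx); have {}cx : context (eval chk_bad s) by apply: context_frame.
rewrite subn_eq0 leqNgt if_neg -/(bad nb v); case: (bad nb v); last by case: cx.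
rewrite [true && _]/(~~ chk n nb v u).
have [R10 R9] := chk_commonP cx.
have {}cx : context s2 by apply: context_frame.
have B8 := chk_branchP cx; rewrite [reg s2 9]R9 in B8.
have F10 : reg s3 10 = reg s2 10 by apply: frame_reg.
have {}cx : context s3 by apply: context_frame.
suff [cx4 R4] : context s4 /\ (reg s4 10 == 0) = chk n nb v u.
  rewrite -R4; case: (reg s4 10 == 0); first by case: cx4.
  by case: (s4).
rewrite /s4 [reg s3 8]B8 (_ : (diff (tf nb v) 1 == 0) = (tf nb v == 1)); last by lia.
rewrite /chk /bad; case: (tf nb v == 1).
  have cx' : context (eval chk_hub s3) by apply: context_frame.
  split; first by apply: context_frame.
  rewrite (chk_dgP cx') (chk_hubP cx) F10 [reg s2 10]R10.
  by set b1 := _ == 0; set b2 := [&& _, _ & _]; rewrite /b1 /b2; lia.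
have cx1 : context (eval chk_r2 s3) by apply: context_frame.
have cx2 : context (eval chk_th (eval chk_r2 s3)) by apply: context_frame.
have cx3 : context (eval chk_2tf (eval chk_th (eval chk_r2 s3))) by apply: context_frame.
split; first by apply: context_frame.
rewrite (chk_cntP cx3) (chk_2tfP cx2) (chk_thP cx1) (chk_r2P cx) F10 [reg s2 10]R10.
set sq := _ * _; lia.
Qed.
End Check.

Lemma chk_advances : advances 13 chk_pass.
Proof.
apply: (@pull_advances 13 _ _ (fun v u a =>
  if bad nb v && ~~ chk n nb v u then 0 else a) (fun=> 1)) => //.
- by move=> v [R A] vn [/= R1 _ _] _ _; rewrite /upd /= R1.
- move=> v u s vn uv [R1 _ _] kn R4 R6.
  exact: (chk_bodyP vn uv kn).
move=> v vn; rewrite (foldl_reset (fun u => bad nb v && ~~ chk n nb v u)) /spec /=.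
case: (bad nb v) => /=; last by rewrite has_pred0.
by rewrite has_predC; case: all.
Qed.

Definition verdict := cmds
  [:: Op (OConst 8 0); load 9 14 8; Op (OConst 0 0);
      IfZ 9 (IfZ 2 Skip (Op (OConst 0 1))) Skip].

Definition achieves k cs C := forall s, stage k s ->
  reg (eval (cmds cs) s) 0 = accept n nb /\ cost (cmds cs) s <= C * (1000 * (volume + 1)).

Lemma achieves_cons k c cs C : advances k c -> achieves k.+1 cs C -> achieves k (c :: cs) C.+1.
Proof.
move=> adv ach s /adv[st co]; have [res co'] := ach _ st.
by split; rewrite //= mulSn leq_add.
Qed.

Lemma verdict_correct : achieves 15 [:: verdict] 1.
Proof.
move=> [R A] [[_ R2 _] [kn _] _]; split; last first.
  by apply: leq_trans (cost_loopfree _ _) _; rewrite // mul1n -[max_cost _]muln1 leq_mul // addn1.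
rewrite /= in R2 kn; rewrite /= /upd /= R2; have [n0|n0] := posnP n.
  (* Nothing is known about cell 0 of array 14 here, but both branches give 0. *)
  by rewrite n0; case: ifP.
rewrite kn // /spec /= (_ : accept n nb = (\sum_(v < n) (0 == 0) *
  ~~ (bad nb v ==> all (chk n nb v) (nb v)) == 0)); last first.
  rewrite /accept n0 sum_nat_eq0; apply/allP/forallP => h v.
    by rewrite h // mem_iota /= add0n.
  rewrite mem_iota /= add0n => vn; have := h (Ordinal vn).
  by rewrite /= mul1n; case: (_ ==> _).
by case: (_ == 0).
Qed.

Definition main := cmds
  ([:: Op (OConst 1 1); Op (OConst 8 0); load 2 0 8; Op (OConst 11 0)] ++
   [:: matrix_pass; deg_pass; hub_pass; far_pass; rp_pass; cov_pass; tf_pass; th_pass;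
      sq_pass; r1_pass; r2_pass; cnt_pass; chk_pass; fin_pass; verdict]).

Lemma main_correct s : stored_input s -> arr s 0 0 = n ->
  (forall a i, 0 < a < 32 -> arr s a i = 0) ->
  reg (eval main s) 0 = accept n nb /\ cost main s <= 20 * (1000 * (volume + 1)).
Proof.
case: s => R A si A00 z; rewrite /= in A00 z.
pose s1 := St (upd (upd (upd (upd R 1 1) 8 0) 2 n) 11 0) A.
have evE cs : eval (cmds ([:: Op (OConst 1 1); Op (OConst 8 0); load 2 0 8;
  Op (OConst 11 0)] ++ cs))
    (St R A) = eval (cmds cs) s1.
  by rewrite [LHS]/= /s1 [upd _ _ _ 8]/upd /= A00.
have coE cs : cost (cmds ([:: Op (OConst 1 1); Op (OConst 8 0); load 2 0 8;
  Op (OConst 11 0)] ++ cs))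
    (St R A) = 12 + cost (cmds cs) s1.
  by rewrite [LHS]/= /s1 [upd _ _ _ 8]/upd /= A00.
rewrite /main evE coE.
have bs : base s1 by split; rewrite /s1 /= /upd.
have [st2 co2] := matrix_passP bs z erefl.
have : achieves 2 [:: deg_pass; hub_pass; far_pass; rp_pass; cov_pass; tf_pass; th_pass;
      sq_pass; r1_pass; r2_pass; cnt_pass; chk_pass; fin_pass; verdict] 14.
  do [apply: achieves_cons; first exact: deg_advances].
  do [apply: achieves_cons; first exact: hub_advances].
  do [apply: achieves_cons; first exact: far_advances].
  do [apply: achieves_cons; first exact: rp_advances].
  do [apply: achieves_cons; first exact: cov_advances].
  do [apply: achieves_cons; first exact: tf_advances].
  do [apply: achieves_cons; first exact: th_advances].
  do [apply: achieves_cons; first exact: sq_advances].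
  do [apply: achieves_cons; first exact: r1_advances].
  do [apply: achieves_cons; first exact: r2_advances].
  do [apply: achieves_cons; first exact: cnt_advances].
  do [apply: achieves_cons; first exact: chk_advances].
  do [apply: achieves_cons; first exact: fin_advances].
  exact: verdict_correct.
move=> /(_ _ st2)[res co]; split; first exact: res.
move: co co2; set cs := cmds _;
  rewrite [cost (cmds _) s1]/(cost matrix_pass s1 + cost cs (eval matrix_pass s1)).
set c1 := cost _ _; set c2 := cost _ _; lia.
Qed.
End Passes.

(** * Relocating the input *)

(* The input occupies the cells that serve as registers. Only cell 0 can be
   used at first: doubling it six times yields an address beyond the input,
   from which on cells 1-17 are saved, after which they are free. *)
Definition save_code : program :=
  nseq 6 (IAdd 0 0 0) ++ [:: IStore 0 1; IConst 1 1]
  ++ flatten [seq [:: IAdd 0 0 1; IStore 0 j] | j <- iota 2 16]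
  ++ [:: IAdd 12 0 0; IConst 3 1; IConst 4 0; IAdd 4 4 12; IConst 5 0; IAdd 5 5 0; IConst 6 32].

(** Register 5 gives the number of cells, 3 the source and 4 the target; the stride 32 places the
    words in array 0. *)
Definition copy_code o : program :=
  [:: IJz 5 (o + 7); ILoad 7 3; IStore 4 7; IAdd 3 3 1; IAdd 4 4 6; ISub 5 5 1; IJmp o].

(** The first copy reads cells 1 to 17 after they have been put to other use. The second one
    overwrites these 17 entries with the saved values, which start 16 cells below the address in
    register 0. *)
Definition restore_code : program :=
  [:: IConst 5 16; ISub 3 0 5; IConst 4 0; IAdd 4 4 12; IConst 5 17].

(** The doublings destroy the input length, so the first copy moves 64 times that length plus 16
    cells; the surplus lands in array 0 beyond the input and leaves the other arrays zero. *)
Definition prologue : program :=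
  let o1 := size save_code in
  let o2 := o1 + 7 + size restore_code in
  save_code ++ copy_code o1 ++ restore_code ++ copy_code o2 ++ [:: IConst 17 1].

Lemma double_effect k m :
  let m' := foldl effect m (nseq k (IAdd 0 0 0)) in
  m' 0 = 2 ^ k * m 0 /\ forall x, x != 0 -> m' x = m x.
Proof.
elim: k m => [|k IH] m /=; first by rewrite expn0 mul1n.
have [E0 Ex] := IH (effect m (IAdd 0 0 0)); split.
  by rewrite E0 /effect /= /upd /= expnSr; lia.
by move=> x x0; rewrite Ex // /effect /= /upd (negPf x0).
Qed.

Lemma save_effect k j m : m 1 = 1 -> 1 < j -> j + k <= m 0 ->
  let m' := foldl effect m (flatten [seq [:: IAdd 0 0 1; IStore 0 i] | i <- iota j k]) in
  [/\ m' 0 = m 0 + k, forall i, i < k -> m' (m 0 + 1 + i) = m (j + i) &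
    forall x, 0 < x -> (x <= m 0) || (m 0 + k < x) -> m' x = m x].
Proof.
elim: k j m => [|k IH] j m m1 j1 jk /=; first by rewrite addn0.
set m2 := effect (effect m _) _.
have E0 : m2 0 = m 0 + 1 by rewrite /m2 /effect /= /upd /= m1; case: eqP => //; lia.
have Es : m2 (m 0 + 1) = m j.
  by rewrite /m2 /effect /= /upd /= m1 eqxx; case: eqP => //; lia.
have Ex x : x != 0 -> x != m 0 + 1 -> m2 x = m x.
  by move=> x0 xs; rewrite /m2 /effect /= /upd /= m1 (negPf x0) (negPf xs).
have [|||F0 Fs Fx] := IH j.+1 m2; rewrite ?E0 ?Ex //; try lia.
split.
- by rewrite F0 E0; lia.
- case=> [|i] ik; first by rewrite !addn0 Fx ?E0 ?Es //; lia.
  have := Fs i ik; rewrite E0 (_ : m 0 + 1 + 1 + i = m 0 + 1 + i.+1); last by lia.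
  by move=> ->; rewrite Ex ?addSnnS //; lia.
by move=> x x0 xm; rewrite Fx ?E0 ?Ex //; lia.
Qed.

(** Source cells below 8 are excluded because the loop uses some of them as registers. The target
    starts beyond the source, so no cell is overwritten by a copied word before it is read. *)
Lemma copy_loop P o : code_at P o (copy_code o) -> forall c p q m,
  [/\ m 1 = 1, m 6 = 32, m 3 = p, m 4 = q & m 5 = c] -> p + c <= q -> 18 <= q ->
  exists m', [/\ run P (7 * c + 1) (State o m) = State (o + 7) m',
    forall x, x \notin [:: 3; 4; 5; 7] -> (forall k, k < c -> x != q + 32 * k) -> m' x = m x &
    forall k, k < c -> 8 <= p + k -> m' (q + 32 * k) = m (p + k)].
Proof.
move=> at0.
have at1 := code_at_cons at0; have at2 := code_at_cons at1; have at3 := code_at_cons at2.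
have at4 := code_at_cons at3; have at5 := code_at_cons at4; have at6 := code_at_cons at5.
elim=> [|c IH] p q m [m1 m6 m3 m4 m5] pq q18.
  by exists m; split => //; rewrite (run1 _ at0) /= m5.
pose f m i := effect m i.
pose m2 := foldl f m [:: ILoad 7 3; IStore 4 7; IAdd 3 3 1; IAdd 4 4 6; ISub 5 5 1].
have step7 : run P 7 (State o m) = State o m2.
  rewrite -[7]/(1 + (1 + (1 + (1 + (1 + (1 + 1)))))) run_add (run1 _ at0) /= m5 /=.
  rewrite run_add (run1 _ at1) [exec_instr _ _ _]/=.
  rewrite run_add (run1 _ at2) [exec_instr _ _ _]/=.
  rewrite run_add (run1 _ at3) [exec_instr _ _ _]/=.
  rewrite run_add (run1 _ at4) [exec_instr _ _ _]/=.
  rewrite run_add (run1 _ at5) [exec_instr _ _ _]/=.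
  by rewrite (run1 _ at6) [exec_instr _ _ _]/=.
have Ex x : x \notin [:: 3; 4; 5; 7] -> x != q -> m2 x = m x.
  rewrite !inE !negb_or => /and4P[x3 x4 x5 x7] xq.
  by rewrite /m2 /f /effect /= /upd /= m4 (negPf x3) (negPf x4) (negPf x5) (negPf x7) (negPf xq).
have Eq : m2 q = m p.
  rewrite /m2 /f /effect /= /upd /= m4 m3 eqxx.
  by do 3 (case: eqP => [|_]; first by lia).
have E3 : m2 3 = p + 1.
  rewrite /m2 /f /effect /= /upd /= m4.
  by do ![case: eqP => [|_]; first by lia]; rewrite m1 m3.
have E4 : m2 4 = q + 32.
  rewrite /m2 /f /effect /= /upd /= m4.
  by do ![case: eqP => [|_]; first by lia]; rewrite m6.
have E5 : m2 5 = c.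
  rewrite /m2 /f /effect /= /upd /= m4.
  by do ![case: eqP => [|_]; first by lia]; rewrite m1 m5 subn1.
have [|||m' [R' X' C']] := IH (p + 1) (q + 32) m2; try lia.
  by rewrite E3 E4 E5 !Ex //; lia.
exists m'; split.
- have -> : 7 * c.+1 + 1 = 7 + (7 * c + 1) by lia.
  by rewrite (run_add P 7) step7.
- move=> x xn xk; rewrite X' // ?Ex //; first by have := xk 0 isT; lia.
  by move=> k kc; have := xk k.+1 kc; lia.
case=> [|k] kc pk.
  rewrite muln0 !addn0 in pk *; rewrite X' ?Eq // ?inE; first by lia.
  by move=> k _; lia.
have := C' k kc; rewrite (_ : q + 32 + 32 * k = q + 32 * k.+1); last by lia.
rewrite (_ : p + 1 + k = p + k.+1); last by lia.
move=> ->; last by lia.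
by rewrite Ex // ?inE; lia.
Qed.

Lemma first_save_effect m : 64 <= m 0 ->
  let m' := foldl effect m [:: IStore 0 1; IConst 1 1] in
  [/\ m' 0 = m 0, m' 1 = 1, m' (m 0) = m 1 & forall x, 1 < x -> x != m 0 -> m' x = m x].
Proof.
move=> m0; split=> [||| x x1 xm]; rewrite /effect /= /upd /= ?eqxx ?(negPf xm) //.
- by case: eqP => //; lia.
- by case: eqP => //; lia.
- by case: eqP => //; lia.
Qed.

Lemma setup_effect m :
  let m' := foldl effect m
    [:: IAdd 12 0 0; IConst 3 1; IConst 4 0; IAdd 4 4 12; IConst 5 0; IAdd 5 5 0; IConst 6 32] in
  [/\ m' 3 = 1, m' 4 = m 0 + m 0 /\ m' 5 = m 0, m' 6 = 32 /\ m' 12 = m 0 + m 0 &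
    forall x, x \notin [:: 3; 4; 5; 6; 12] -> m' x = m x].
Proof.
split=> [|||x]; try by [].
rewrite !inE !negb_or => /and5P[x3 x4 x5 x6 x12].
by rewrite /effect /= /upd /= (negPf x3) (negPf x4) (negPf x5) (negPf x6) (negPf x12).
Qed.

Lemma save_correct orig : 0 < orig 0 ->
  let m := foldl effect orig save_code in
  let Y := 64 * orig 0 in
  [/\ [/\ m 0 = Y + 16, m 1 = 1 & m 3 = 1], m 4 = Y + 16 + (Y + 16) /\ m 5 = Y + 16,
      m 6 = 32 /\ m 12 = Y + 16 + (Y + 16),
      forall i, i < 17 -> m (Y + i) = orig i.+1 &
      forall x, 17 < x -> (x < Y) || (Y + 16 < x) -> m x = orig x].
Proof.
move=> L0; rewrite /save_code; cbv zeta; rewrite 3!foldl_cat.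
have [] := double_effect 6 orig.
move: (foldl effect orig (nseq 6 (IAdd 0 0 0))) => ma.
have -> : 2 ^ 6 * orig 0 = 64 * orig 0 by lia.
have : 64 <= 64 * orig 0 by lia.
move: (64 * orig 0) => Y Y64 ma0 max.
have [] := @first_save_effect ma; first by rewrite ma0.
move: (foldl effect ma _) => mb; rewrite ma0 => mb0 mb1 mbY mbx.
have [//||] := @save_effect 16 2 mb mb1; first by rewrite mb0; lia.
move: (foldl effect mb _) => mc; rewrite mb0 => mc0 mcs mcx.
have [] := setup_effect mc; move: (foldl effect mc _) => m m3 m45 m612 mx.
rewrite mc0 in m45 m612; split => //.
- split; [by rewrite mx | rewrite mx // | exact: m3].
  by rewrite mcx ?mb1 //; lia.
- case=> [|i] i17; rewrite mx ?inE; try lia.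
    by rewrite addn0 mcx ?mbY ?max //; lia.
  by rewrite -addn1 (addnC i) addnA mcs // mbx ?max //; lia.
by move=> x x17 xY; rewrite mx ?inE ?mcx ?mbx ?max //; lia.
Qed.

Lemma restore_correct m Y : m 0 = Y + 16 ->
  let m' := foldl effect m restore_code in
  [/\ m' 3 = Y, m' 4 = m 12, m' 5 = 17 & forall x, x \notin [:: 3; 4; 5] -> m' x = m x].
Proof.
move=> m0; split => [|||x].
- by rewrite /effect /= /upd /= m0 addnK.
- by [].
- by [].
rewrite !inE !negb_or => /and3P[x3 x4 x5].
by rewrite /effect /= /upd /= (negPf x3) (negPf x4) (negPf x5).
Qed.

Lemma prologue_correct P w : 0 < size w -> code_at P 0 prologue ->
  exists m B, [/\ run P (size save_code + (7 * (64 * size w + 16) + 1)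
        + (size restore_code + (7 * 17 + 1) + 1)) (init_state w) = State (size prologue) m,
    [/\ m 12 = B, m 17 = 1 & 18 <= B],
    forall i, i < size w -> m (B + 32 * i) = nth 0 w i &
    forall a i, 0 < a < 32 -> m (B + 32 * i + a) = 0].
Proof.
move=> w0 at0; set L := size w in w0 *.
pose orig a := if a is a'.+1 then nth 0 w a' else L.
have atS : code_at P 0 save_code by case/code_at_cat: at0.
have /code_at_cat[_ atr] := at0; rewrite add0n in atr.
have /code_at_cat[atC1 atr2] := atr.
have /code_at_cat[atR atr3] := atr2.
have /code_at_cat[atC2 atL] := atr3.
have jfS : all jumpfree save_code by [].
have jfR : all jumpfree restore_code by [].
have runS := run_jumpfree orig jfS atS; rewrite add0n in runS.
have := @save_correct orig w0; cbv zeta; move: runS.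
move: (foldl effect orig save_code) => m1 runS; rewrite -[orig 0]/L.
have YL : L < 64 * L by lia.
have Y64 : 64 <= 64 * L by lia.
move: (64 * L) YL Y64 => Y YL Y64.
move=> [[m1_0 m1_1 m1_3] [m1_4 m1_5] [m1_6 m1_12] saved mcorig].
pose B := Y + 16 + (Y + 16); rewrite -/B in m1_4 m1_12.
have [|||m2 [run2 m2x m2c]] := copy_loop atC1 (c := Y + 16) (p := 1) (q := B) (m := m1).
- by split.
- by rewrite /B; lia.
- by rewrite /B; lia.
have runR := run_jumpfree m2 jfR atR.
have lowE x : x < B -> x \notin [:: 3; 4; 5; 7] -> m2 x = m1 x.
  by move=> xB xn; apply: m2x => // k _; lia.
have B18 : 18 <= B by rewrite /B; lia.
have low x : x < 18 -> x < B by move=> x18; apply: leq_trans B18.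
have m2_0 : m2 0 = Y + 16 by rewrite lowE // low.
have := restore_correct m2_0; cbv zeta; move: runR; move: (foldl effect m2 _) => m3 runR.
rewrite [m2 12]lowE ?low // m1_12 => -[m3_3 m3_4 m3_5 m3x].
have [|||m4 [run4 m4x m4c]] := copy_loop atC2 (c := 17) (p := Y) (q := B) (m := m3).
- by split; rewrite // m3x // lowE ?low.
- by rewrite /B; lia.
- exact: B18.
pose m5 := upd m4 17 1.
exists m5, B; split.
- rewrite -[init_state w]/(State 0 orig).
  move: run2 runR run4; set t2 := 7 * _ + 1; set t4 := 7 * _ + 1 => run2 runR run4.
  rewrite (run_add P (_ + t2)) (run_add P _ t2) runS run2.
  by rewrite (run_add P (_ + t4)) (run_add P _ t4) runR run4 (run1 _ atL).
- have m5_12 : m5 12 = m4 12 by [].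
  have m4_12 : m4 12 = m3 12 by apply: m4x => // k _; have := low 12 isT; lia.
  by split; rewrite // m5_12 m4_12 m3x // lowE ?low.
- move=> i iL; rewrite /m5 /upd; case: eqP => [|_]; first by lia.
  (* Words 0 to 16 stood in cells 1 to 17 and come from the saved block; the later ones stood in
     cells from 18 on and come from the first copy. *)
  have [i17|i17] := ltnP i 17.
    rewrite m4c //; last by lia.
    rewrite m3x ?inE; last by lia.
    by rewrite lowE ?saved // ?inE /B; lia.
  rewrite m4x; first last.
  + by move=> k k17; lia.
  + by rewrite !inE; lia.
  rewrite m3x ?inE; last by lia.
  rewrite m2c; [|lia|lia].
  by rewrite mcorig //; lia.
move=> a i a32; rewrite /m5 /upd; case: eqP => [|_]; first by lia.
rewrite m4x ?inE; [|lia|move=> k _; lia].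
rewrite m3x ?inE; last by lia.
rewrite m2x ?inE; [|lia|move=> k _; lia].
rewrite mcorig; [|lia|rewrite /B; lia].
by rewrite /orig (_ : B + 32 * i + a = (B + 32 * i + a).-1.+1) ?nth_default // -/L /B; lia.
Qed.

(** * Correctness and running time *)

Section Encoding.
Variable Ls : seq (seq nat).
Let record (l : seq nat) := size l :: l.

Definition offset v := \sum_(i < v) (size (nth [::] Ls i)).+1.

Lemma drop_offset v : v <= size Ls ->
  drop (offset v) (flatten (map record Ls)) = flatten (map record (drop v Ls)).
Proof.
elim: v => [|v IH] vn; first by rewrite /offset big_ord0 !drop0.
rewrite {1}/offset big_ord_recr /= -/(offset v) addnC -drop_drop IH; last exact: ltnW.
by rewrite (drop_nth [::] vn) /= drop_size_cat.
Qed.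

Lemma nth_offset v j : v < size Ls -> j <= size (nth [::] Ls v) ->
  nth 0 (flatten (map record Ls)) (offset v + j) = nth 0 (record (nth [::] Ls v)) j.
Proof.
move=> vn jd; rewrite -nth_drop drop_offset ?(ltnW vn) // (drop_nth [::] vn) [flatten _]/=.
by rewrite -cat_cons nth_cat /= ltnS jd.
Qed.

Lemma size_records : size (flatten (map record Ls)) = offset (size Ls).
Proof.
have := drop_offset (leqnn (size Ls)); rewrite drop_size /= => /(congr1 size).
rewrite size_drop /= => /eqP; rewrite subn_eq0 => le; apply/eqP; rewrite eqn_leq le /=.
rewrite /offset size_flatten sumnE big_map big_map (big_nth [::]) big_mkord.
exact: leqnn.
Qed.

Lemma offset_mono v w : v <= w -> offset v <= offset w.
Proof.
elim: w => [|w IH]; first by rewrite leqn0 => /eqP->.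
rewrite leq_eqVlt => /orP[/eqP->//|/IH vw].
by rewrite {2}/offset big_ord_recr /= -/(offset w); apply: leq_trans vw (leq_addr _ _).
Qed.
End Encoding.

(** Ordered adjacent pairs are covered by the increasing ones and their mirror images. *)
Lemma degree_sum n (e : rel 'I_n) : symmetric e -> irreflexive e ->
  \sum_(v < n) #|nbr e v| <= 2 * num_edges e.
Proof.
move=> esym eirr; rewrite /num_edges; set E := [set p | _].
have -> : \sum_(v < n) #|nbr e v| = #|[set p : 'I_n * 'I_n | e p.1 p.2]|.
  rewrite -sum1dep_card (eq_bigl (fun p : 'I_n * 'I_n => predT p.1 && e p.1 p.2)) //.
  rewrite -(pair_big_dep predT e (fun _ _ => 1)) /=.
  by apply: eq_bigr => v _; rewrite sum1_card; apply: eq_card => u; rewrite inE.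
pose swap (p : 'I_n * 'I_n) := (p.2, p.1).
have swap_inj : injective swap by move=> [a b] [c d] [-> ->].
apply: (@leq_trans #|E :|: swap @: E|).
  apply/subset_leq_card/subsetP => -[a b]; rewrite inE /= => ab; rewrite inE.
  have [lt|gt|eq] := ltngtP (enum_rank a) (enum_rank b).
  - by rewrite inE /= lt ab.
  - by rewrite orbC (_ : (a, b) = swap (b, a)) // imset_f // inE /= gt esym.
  - by move: ab; rewrite (enum_rank_inj (val_inj eq)) eirr.
by rewrite (leq_trans (leq_card_setU _ _)) // card_imset // mul2n addnn.
Qed.

Theorem theorem3 :
  exists (P : program) (c : nat),
    forall (n : nat) (e : rel 'I_n),
      simple_graph e -> diamond_free e ->
      forall adj : 'I_n -> seq 'I_n, adj_lists e adj ->
        exists t : nat,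
          (t <= c * (n + num_edges e + 1))%N /\
          decides_within P (encode_adj adj) (is_CIS e) t.
Proof.
(* [main] takes at most 20000 steps per input cell, and the input has at most 2(|V| + |E| + 1)
   cells; the remaining margin covers the prologue, with 448 steps per cell plus a constant. *)
exists (prologue ++ compile (size prologue) 0 main), (100 * 1000) => n e [esym eirr] df adj adjP.
pose Ls := [seq map (@nat_of_ord n) (adj v) | v <- enum 'I_n].
pose nb v := nth [::] Ls v.
have sLs : size Ls = n by rewrite size_map size_enum_ord.
have nbE (v : 'I_n) : nb v = map val (adj v).
  by rewrite /nb (nth_map v) ?size_enum_ord // nth_ord_enum.
have nb_lt v u : v < n -> u \in nb v -> u < n.
  by move=> vn; rewrite (nbE (Ordinal vn)) => /mapP[w _ ->]; apply: ltn_ord.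
have wE : encode_adj adj = n :: flatten [seq size l :: l | l <- Ls].
  rewrite /encode_adj /Ls -map_comp; congr (_ :: flatten _).
  by apply: eq_map => v; rewrite /= size_map.
have wS : size (encode_adj adj) = volume n nb + 1.
  by rewrite wE /= size_records sLs addn1.
have vol : volume n nb + 1 <= 2 * (n + num_edges e + 1).
  have := degree_sum esym eirr.
  have -> : volume n nb = n + \sum_(v < n) #|nbr e v|.
    rewrite /volume -[X in X + _]card_ord -sum1_card -big_split /=.
    by apply: eq_bigr => v _; rewrite -[size _]/(dg nb v) (dgE adjP nbE).
  lia.
have w0 : 0 < size (encode_adj adj) by rewrite wS addn1.
set P := prologue ++ _.
have at0 : code_at P 0 prologue by exists [::], (compile (size prologue) 0 main).
have at1 : code_at P (size prologue) (compile (size prologue) 0 main).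
  by exists prologue, [::]; rewrite cats0.
have [m [B [run1 mB mW mz]]] := prologue_correct w0 at0.
pose s := St m (fun a i => m (B + 32 * i + a)).
have rep : represents B s m by split.
have si : stored_input n nb s.
  have pos1 v : pos nb v = (offset Ls v).+1 by rewrite /pos add1n.
  have bound v j : v < n -> j <= size (nb v) -> pos nb v + j < size (encode_adj adj).
    move=> vn jd; rewrite wS addn1 ltnS pos1 addSn.
    apply: leq_trans (offset_mono Ls vn).
    by rewrite {2}/offset big_ord_recr /= -/(offset Ls v) addnS ltnS leq_add2l.
  move=> v vn; have cell j : j <= size (nb v) ->
      arr s 0 (pos nb v + j) = nth 0 (size (nb v) :: nb v) j.
    move=> jd; rewrite /= addn0 mW ?bound // wE pos1 addSn /=.
    by rewrite nth_offset ?sLs.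
  split; first by rewrite -[pos nb v]addn0 cell.
  by move=> j jd; rewrite -addnA add1n cell.
have A00 : arr s 0 0 = n by rewrite /= muln0 !addn0 -[B]addn0 -[in B + 0](muln0 32) mW // wE.
have [res co] := main_correct nb_lt si A00 (fun a i => mz a i).
have [m' [run2 rep' _]] := compile_correct (leq0n 2) (isT : cmd_wf 0 main) at1 rep.
rewrite -run1 -run_add in run2.
exists (size save_code + (7 * (64 * size (encode_adj adj) + 16) + 1)
  + (size restore_code + (7 * 17 + 1) + 1) + cost main s); split.
  have sS : size save_code <= 1000 by [].
  have sR : size restore_code <= 1000 by [].
  rewrite wS; move: sS sR vol co; set a1 := size _; set a2 := size _; set a3 := cost _ _.
  set vl := volume n nb; set x := n + _ + 1. lia.
have sP : size P = size prologue + csize main by rewrite size_cat size_compile.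
rewrite /decides_within run2; split; first by rewrite /halted sP; apply: leqnn.
have [mr _ _] := rep'; rewrite /= mr // res.
by rewrite (accept_correct esym eirr df adjP nbE).
Qed.
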